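(* Let $\mathbb{K}$ be a field and let $\Gamma_1,\Gamma_2\subset\mathbb{N}^{r_1+r_2}$ be affine semigroups minimally generated by the disjoint sets $\mathcal{G}_1=\{\mathbf{a}_1,\dots,\mathbf{a}_{r_1+n_1}\}$ and $\mathcal{G}_2=\{\mathbf{b}_1,\dots,\mathbf{b}_{r_2+n_2}\}$, with sets of extremal rays $\{\mathbf{a}_1,\dots,\mathbf{a}_{r_1}\}$ and $\{\mathbf{b}_1,\dots,\mathbf{b}_{r_2}\}$ respectively, and assume that $\{\mathbf{a}_1,\dots,\mathbf{a}_{r_1},\mathbf{b}_1,\dots,\mathbf{b}_{r_2}\}$ is linearly independent over $\mathbb{Q}$. Let $\Gamma_1\sqcup\Gamma_2$ be the join of $\Gamma_1$ and $\Gamma_2$. If $\mathbb{K}[\Gamma_1]$ and $\mathbb{K}[\Gamma_2]$ are Cohen-Macaulay, then $\mathbb{K}[\Gamma_1\sqcup\Gamma_2]$ is Cohen-Macaulay.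
   Context: An affine semigroup is a finitely generated subsemigroup of $\mathbb{N}^m$ containing $0$. An extremal ray of $\Gamma_1$ is the smallest non-zero element of $\Gamma_1$ lying on an extremal ray of the cone $\{\sum\alpha_i\mathbf{a}_i:\alpha_i\in\mathbb{R}_{\ge 0}\}$, and similarly for $\Gamma_2$; thus every element of $\Gamma_1$ (resp. $\Gamma_2$) is a non-negative rational combination of $\mathbf{a}_1,\dots,\mathbf{a}_{r_1}$ (resp. $\mathbf{b}_1,\dots,\mathbf{b}_{r_2}$). The join is the semigroup $\Gamma_1\sqcup\Gamma_2=\langle\mathcal{G}_1\cup\mathcal{G}_2\rangle$. For a semigroup $\Gamma\subset\mathbb{N}^{r_1+r_2}$, $\mathbb{K}[\Gamma]$ is the subalgebra of $\mathbb{K}[t_1,\dots,t_{r_1+r_2}]$ spanned by the monomials $\mathbf{t}^\gamma$, $\gamma\in\Gamma$. *)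

(* Defs.v *)
From HB Require Import structures.
From mathcomp Require Import all_boot all_order all_algebra.
From mathcomp Require Import boolp classical_sets reals.
From mathcomp Require Import mpoly.

Set Implicit Arguments.
Unset Strict Implicit.
Unset Printing Implicit Defensive.

Import Order.TTheory GRing.Theory Num.Theory.

Local Open Scope classical_set_scope.
Local Open Scope ring_scope.

(* [idealr A] and [prime_idealr A] are the library's types of proper ideals and
   of prime ideals; their boolean membership predicates are no restriction,
   since every [Prop]-valued predicate is reflected by [asbool]. *)

Definition ideal_gen (A : comNzRingType) (s : seq A) : set A :=
  [set x | exists c : nat -> A, x = \sum_(i < size s) c i * s`_i].

(* The improper ideal, which [idealr A] leaves out, is generated by 1. *)
Definition noetherian (A : comNzRingType) : Prop :=
  forall I : idealr A, exists s : seq A, forall x, x \in I <-> ideal_gen s x.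

Definition maximal_ideal (A : comNzRingType) (M : idealr A) : Prop :=
  forall J : idealr A, {subset M <= J} -> {subset J <= M}.

Definition prime_chain (A : comNzRingType) (n : nat) : Prop :=
  exists p : 'I_n.+1 -> prime_idealr A, forall i j : 'I_n.+1, (i < j)%N ->
    {subset p i <= p j} /\ ~ {subset p j <= p i}.

Definition has_krull_dim (A : comNzRingType) (d : nat) : Prop :=
  prime_chain A d /\ forall n, prime_chain A n -> (n <= d)%N.

Definition regular_seq (A : comNzRingType) (s : seq A) : Prop :=
  (forall i, (i < size s)%N -> forall x,
     ideal_gen (take i s) (s`_i * x) -> ideal_gen (take i s) x) /\
  ~ ideal_gen s 1.

Definition has_grade (A : comNzRingType) (I : idealr A) (d : nat) : Prop :=
  (exists s, [/\ regular_seq s, {subset s <= I} & size s = d]) /\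
  forall s, regular_seq s -> {subset s <= I} -> (size s <= d)%N.

Definition local_with_max_ideal (A : comNzRingType) (M : idealr A) : Prop :=
  forall I : idealr A, {subset I <= M}.

(* The depth of a local ring is the grade of its maximal ideal; the Krull
   dimension of a noetherian local ring is finite. *)
Definition cohen_macaulay_local (A : comNzRingType) : Prop :=
  noetherian A /\
  exists M : idealr A, local_with_max_ideal M /\
    exists d : nat, has_krull_dim A d /\ has_grade M d.

(* For an integral domain [A], the localization at a prime ideal [P] is the
   subring of all a / s with s outside [P] of the field of fractions. *)
Section Localization.
Variables (A : idomainType) (P : prime_idealr A).

Definition loc_pred : {pred {fraction A}} := fun x =>
  `[< exists a s : A, s \notin P /\ x = tofrac a / tofrac s >].

Lemma loc_predP (x : {fraction A}) :
  reflect (exists a s : A, s \notin P /\ x = tofrac a / tofrac s)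
          (x \in loc_pred).
Proof. exact: asboolP. Qed.

Lemma notin_prime_neq0 (s : A) : s \notin P -> tofrac s != 0.
Proof. by apply: contra; rewrite tofrac_eq0 => /eqP ->; rewrite idealr0. Qed.

Lemma loc_pred_subring : subring_closed loc_pred.
Proof.
split.
- apply/loc_predP; exists 1, 1; split; first by rewrite idealr1.
  by rewrite divr1.
- move=> x y /loc_predP[a [s [sP ->]]] /loc_predP[b [t [tP ->]]].
  apply/loc_predP; exists (a * t - b * s), (s * t).
  split; first by rewrite prime_idealrM negb_or sP.
  have s0 := notin_prime_neq0 sP; have t0 := notin_prime_neq0 tP.
  by rewrite rmorphB !rmorphM /= -[- (_ / _)]mulNr addf_div // mulNr.
- move=> x y /loc_predP[a [s [sP ->]]] /loc_predP[b [t [tP ->]]].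
  apply/loc_predP; exists (a * b), (s * t).
  split; first by rewrite prime_idealrM negb_or sP.
  by rewrite !rmorphM /= mulf_div.
Qed.

HB.instance Definition _ :=
  GRing.isSubringClosed.Build {fraction A} loc_pred loc_pred_subring.

Definition localization : Type := {x : {fraction A} | x \in loc_pred}.

HB.instance Definition _ := SubType.on localization.
HB.instance Definition _ := Choice.on localization.
HB.instance Definition _ :=
  [SubChoice_isSubComNzRing of localization by <:].

End Localization.

Definition cohen_macaulay (A : idomainType) : Prop :=
  noetherian A /\
  forall M : prime_idealr A, maximal_ideal M ->
    cohen_macaulay_local (localization M).

Definition submonoid_closed n (S : set 'X_{1..n}) : Prop :=
  S 0%MM /\ forall u v, S u -> S v -> S (u + v)%MM.

Definition semigroup_span n (G : set 'X_{1..n}) : set 'X_{1..n} :=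
  smallest (@submonoid_closed n) G.

Lemma semigroup_span_closed n (G : set 'X_{1..n}) :
  submonoid_closed (semigroup_span G).
Proof.
split=> [S [[]]//|u v Gu Gv S SG].
by have [[_ SD] _] := SG; apply: SD; [exact: Gu|exact: Gv].
Qed.

Record affine_semigroup (n : nat) := AffineSemigroup {
  asg_set :> set 'X_{1..n};
  asg_fin_gen : exists s : seq 'X_{1..n}, asg_set = semigroup_span [set` s]
}.

Lemma asg_closed n (S : affine_semigroup n) : submonoid_closed S.
Proof. by case: S => ? [s /= ->]; exact: semigroup_span_closed. Qed.

Definition generated_semigroup n (s : seq 'X_{1..n}) : affine_semigroup n :=
  AffineSemigroup (ex_intro _ s erefl).

Definition minimally_generated n (S : set 'X_{1..n}) (G : set 'X_{1..n}) :=
  semigroup_span G = S /\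
  forall H : set 'X_{1..n}, H `<=` G -> semigroup_span H = S -> H = G.

(* The two arguments list the generating sets of the two semigroups. *)
Definition semigroup_join n (s1 s2 : seq 'X_{1..n}) : affine_semigroup n :=
  generated_semigroup (s1 ++ s2).

Definition mnm_row (F : pzSemiRingType) n (m : 'X_{1..n}) : 'rV[F]_n :=
  \row_j (m j)%:R.

Definition cone (R : realType) n k (a : 'I_k -> 'X_{1..n}) : set 'rV[R]_n :=
  [set v | exists c : 'I_k -> R,
     (forall i, 0 <= c i) /\ v = \sum_i c i *: mnm_row R (a i)].

Arguments cone R {n k} a _.

Definition ray (R : realType) n (v : 'rV[R]_n) : set 'rV[R]_n :=
  [set t *: v | t in [set t : R | 0 <= t]].

(* A half-line that is a face of the cone [C]. *)
Definition extremal_ray_of_cone (R : realType) n (C L : set 'rV[R]_n) : Prop :=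
  [/\ exists2 v, v != 0 & L = ray v, L `<=` C &
      forall x y, C x -> C y -> L (x + y) -> L x /\ L y].

(* The elements of N^n on a given ray are totally ordered by the componentwise
   order [(_ <= _)%MM]. *)
Definition extremal_rays (R : realType) n k (a : 'I_k -> 'X_{1..n})
    (S : set 'X_{1..n}) : set 'X_{1..n} :=
  [set v | [/\ S v, v != 0%MM & exists L : set 'rV[R]_n,
     [/\ extremal_ray_of_cone (cone R a) L, L (mnm_row R v) &
         forall w, S w -> w != 0%MM -> L (mnm_row R w) -> (v <= w)%MM]]].

Arguments extremal_rays R {n k} a S _.

Section SemigroupAlgebra.
Variables (K : fieldType) (n : nat) (S : affine_semigroup n).

(* A polynomial is in the span of the monomials 'X_[m] with [m] in [S] iff all
   the monomials of its support have this form. *)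
Definition sga_pred : {pred {mpoly K[n]}} := fun p =>
  `[< forall m, m \in msupp p -> asg_set S m >].

Lemma sga_predP (p : {mpoly K[n]}) :
  reflect (forall m, m \in msupp p -> asg_set S m) (p \in sga_pred).
Proof. exact: asboolP. Qed.

(* [x / y] is [x * y] when [y] is not a unit, and the units of {mpoly K[n]} are
   the nonzero constants; hence the closure under division. *)
Lemma sga_pred_divring : divring_closed sga_pred.
Proof.
have [S0 SD] := asg_closed S.
have SM p q : p \in sga_pred -> q \in sga_pred -> p * q \in sga_pred.
  move=> /sga_predP Sp /sga_predP Sq; apply/sga_predP => m.
  move=> /msuppM_le/allpairsP[[u v] /= [/Sp Su /Sq Sv ->]].
  exact: SD.
have SC (c : K) : c%:MP_[n] \in sga_pred.
  apply/sga_predP => m; rewrite msuppC; case: ifP => // _.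
  by rewrite inE => /eqP ->.
split.
- by rewrite -mpolyC1; exact: SC.
- move=> p q /sga_predP Sp /sga_predP Sq; apply/sga_predP => m.
  by move=> /msuppB_le; rewrite mem_cat => /orP[/Sp|/Sq].
- move=> p q Sp Sq; apply: SM => //.
  have [qU|/invr_out -> //] := boolP (q \is a GRing.unit).
  have /andP[/eqP qE cU] : (q == (q@_0)%:MP) && (q@_0 \in GRing.unit) by [].
  by rewrite qE -rmorphV //=; exact: SC.
Qed.

HB.instance Definition _ :=
  GRing.isDivringClosed.Build {mpoly K[n]} sga_pred sga_pred_divring.

Definition semigroup_algebra : Type := {p : {mpoly K[n]} | p \in sga_pred}.

HB.instance Definition _ := SubType.on semigroup_algebra.
HB.instance Definition _ := Choice.on semigroup_algebra.
HB.instance Definition _ :=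
  [SubChoice_isSubIntegralDomain of semigroup_algebra by <:].

End SemigroupAlgebra.

(* Main.v *)
(* Let e_1, ..., e_r be linearly independent elements of an affine semigroup S,
   over which S is integral, and let x_1, ..., x_r be the corresponding
   monomials of A = K[S]. Both directions of the following criterion are used:
   A is Cohen-Macaulay iff g + e_j, g + e_l in S with j <> l imply g in S, for
   all g in the group of S. Given the criterion, the corollary is combinatorial:
   by linear independence every element of the join is u + v for unique
   u in Gamma_1 and v in Gamma_2, so that a failure of the condition for the
   join comes from Gamma_1 or from Gamma_2.

   Necessity. Localize A at the ideal of the elements without constant term. The
   faces of S give a chain of primes of length r, so that the depth is at least
   r. If the condition fails for u = g + e_j, then some associated prime P of
   (x_j) contains x_j and x_l. In a local ring of depth at least r, an
   associated prime of a regular element starts a chain of primes of length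
   r - 1, whereas modulo x_j and x_l the algebra A grows like a polynomial of
   degree r - 2, which excludes such a chain above P.

   Sufficiency. Let M be a maximal ideal of A. By the Nullstellensatz M contains
   f_l(x_l) for some non-zero polynomials f_l in one variable. The condition
   makes the remainder modulo f_l(x_l) a well-defined operator on A that commutes
   with the other x_j, hence f_1(x_1), ..., f_r(x_r) is a regular sequence, and
   the growth of A bounds the dimension by r. *)
Require Import Defs.
From HB Require Import structures.
From mathcomp Require Import all_boot all_order all_algebra.
From mathcomp Require Import boolp classical_sets reals.
From mathcomp Require Import mpoly ring zify.

Set Implicit Arguments.
Unset Strict Implicit.
Unset Printing Implicit Defensive.

Import Order.TTheory GRing.Theory Num.Theory.

Local Open Scope classical_set_scope.
Local Open Scope ring_scope.


(** * Ideals, associated primes and chains of primes *)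

Section Ideals.
Variable R : comNzRingType.
Implicit Types (I J P Q U : set R) (s : seq R).

Definition is_ideal I :=
  [/\ I 0, forall x y, I x -> I y -> I (x + y) & forall c x, I x -> I (c * x)].

Lemma id0 I : is_ideal I -> I 0. Proof. by case. Qed.
Lemma idD I x y : is_ideal I -> I x -> I y -> I (x + y).
Proof. by case=> _ + _; apply. Qed.
Lemma idMl I c x : is_ideal I -> I x -> I (c * x).
Proof. by case=> _ _; apply. Qed.
Lemma idMr I c x : is_ideal I -> I x -> I (x * c).
Proof. by rewrite mulrC; exact: idMl. Qed.
Lemma idN I x : is_ideal I -> I x -> I (- x).
Proof. by rewrite -mulN1r; exact: idMl. Qed.
Lemma idB I x y : is_ideal I -> I x -> I y -> I (x - y).
Proof. by move=> iI Ix Iy; apply: idD => //; exact: idN. Qed.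
Lemma idDr I x y : is_ideal I -> I y -> I (x + y) -> I x.
Proof. by move=> iI Iy Ixy; rewrite -(addrK y x); exact: idB. Qed.
Lemma id_sum I (T : Type) (r : seq T) (p : pred T) (F : T -> R) :
  is_ideal I -> (forall t, p t -> I (F t)) -> I (\sum_(t <- r | p t) F t).
Proof.
by move=> iI H; elim/big_ind: _ => //; [exact: id0|move=> x y; exact: idD].
Qed.

Definition is_prime P :=
  [/\ is_ideal P, ~ P 1 & forall x y, P (x * y) -> P x \/ P y].

Lemma prime_exp P x n : is_prime P -> P (x ^+ n) -> P x.
Proof.
case=> iP P1 PM; elim: n => [|n IH]; first by rewrite expr0.
by rewrite exprS => /PM[|/IH].
Qed.

Lemma idealr_is_ideal (J : idealr R) : is_ideal [set x | x \in J].
Proof.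
split=> /= [|x y|c x]; first exact: idealr0; first by move=> ? ?; rewrite rpredD.
exact: idealMr.
Qed.

Lemma is_ideal_idealr I : is_ideal I -> ~ I 1 ->
  exists J : idealr R, forall x, x \in J <-> I x.
Proof.
move=> iI I1; pose S : {pred R} := fun x => `[< I x >].
have SC : idealr_closed S.
  split=> [||a u v]; [by apply/asboolP; exact: id0|by apply/asboolP|].
  by move=> /asboolP Iu /asboolP Iv; apply/asboolP; apply: idD => //; exact: idMl.
pose IM := isIdealr.Build R S SC.
pose J : idealr R := HB.pack S IM.
by exists J => x; split=> [/asboolP|?]//; apply/asboolP.
Qed.

Lemma prime_idealr_is_prime (J : prime_idealr R) : is_prime [set x | x \in J].
Proof.
split; [exact: idealr_is_ideal| by rewrite /= idealr1|].
by move=> x y /=; rewrite prime_idealrM => /orP.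
Qed.

Lemma is_prime_prime_idealr P : is_prime P ->
  exists J : prime_idealr R, forall x, x \in J <-> P x.
Proof.
move=> [iI I1 IM]; pose S : {pred R} := fun x => `[< P x >].
have SC : idealr_closed S.
  split=> [||a u v]; [by apply/asboolP; exact: id0|by apply/asboolP|].
  by move=> /asboolP Iu /asboolP Iv; apply/asboolP; apply: idD => //; exact: idMl.
have SP : prime_idealr_closed S.
  by move=> u v /asboolP/IM[] H; apply/orP; [left|right]; apply/asboolP.
pose M1 := isIdealr.Build R S SC.
pose M2 := isPrimeIdealrClosed.Build R S SP.
pose J : prime_idealr R := HB.pack S M1 M2.
by exists J => x; split=> [/asboolP|?]//; apply/asboolP.
Qed.

Lemma ideal_gen_ideal s : is_ideal (ideal_gen s).
Proof.
split=> [|x y [c ->] [d ->]|a x [c ->]].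
- by exists (fun=> 0); rewrite big1 // => i _; rewrite mul0r.
- exists (fun i => c i + d i); rewrite -big_split.
  by apply: eq_bigr => i _; rewrite mulrDl.
- exists (fun i => a * c i); rewrite mulr_sumr.
  by apply: eq_bigr => i _; rewrite mulrA.
Qed.

Lemma ideal_gen_nth s i : (i < size s)%N -> ideal_gen s s`_i.
Proof.
move=> si; exists (fun j => (j == i)%:R).
rewrite (bigD1 (Ordinal si)) //= eqxx mul1r big1 ?addr0 // => j.
by rewrite -val_eqE /= => /negPf ->; rewrite mul0r.
Qed.

Lemma ideal_gen_mem s x : x \in s -> ideal_gen s x.
Proof. by move=> xs; rewrite -(nth_index 0 xs); apply/ideal_gen_nth; rewrite index_mem. Qed.

Lemma ideal_gen_sub s I : is_ideal I -> (forall x, x \in s -> I x) ->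
  ideal_gen s `<=` I.
Proof.
by move=> iI sI x [c ->]; apply: id_sum => // i _; apply: idMl => //; apply: sI; exact: mem_nth.
Qed.

Lemma ideal_gen_nil : ideal_gen [::] = [set (0 : R)].
Proof.
apply/seteqP; split=> [x [c ->]|x ->]; first by rewrite big_ord0.
apply: id0; exact: ideal_gen_ideal.
Qed.

Lemma zero_ideal : is_ideal [set 0].
Proof. by rewrite -ideal_gen_nil; exact: ideal_gen_ideal. Qed.

Definition add_ideal I y : set R := [set x | exists i c, I i /\ x = i + c * y].

Lemma add_ideal_ideal I y : is_ideal I -> is_ideal (add_ideal I y).
Proof.
move=> iI; split=> [|x z [i [c [Ii ->]]] [j [d [Ij ->]]]|a x [i [c [Ii ->]]]].
- by exists 0, 0; split; [exact: id0|rewrite mul0r addr0].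
- exists (i + j), (c + d); split; [exact: idD|by rewrite mulrDl addrACA].
- exists (a * i), (a * c); split; [exact: idMl|by rewrite mulrDr mulrA].
Qed.

Lemma sub_add_ideal I y : I `<=` add_ideal I y.
Proof. by move=> x Ix; exists x, 0; rewrite mul0r addr0. Qed.

Lemma add_ideal_mem I y : is_ideal I -> add_ideal I y y.
Proof. by move=> iI; exists 0, 1; rewrite mul1r add0r; split=> //; exact: id0. Qed.

Lemma add_ideal_sub I J y : is_ideal J -> I `<=` J -> J y -> add_ideal I y `<=` J.
Proof. by move=> iJ IJ Jy x [i [c [Ii ->]]]; apply: idD; [|exact: IJ|exact: idMl]. Qed.

Lemma add_idealC I x y : add_ideal (add_ideal I x) y = add_ideal (add_ideal I y) x.
Proof.
apply/seteqP; split=> z [_ [c [[i [d [Ii ->]]] ->]]].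
  by exists (i + c * y), d; split; [exists i, c|rewrite addrAC].
by exists (i + c * x), d; split; [exists i, c|rewrite addrAC].
Qed.

Lemma ideal_gen_rcons s y : ideal_gen (rcons s y) = add_ideal (ideal_gen s) y.
Proof.
apply/seteqP; split.
  apply: ideal_gen_sub => [|x]; first exact: (add_ideal_ideal _ (@ideal_gen_ideal _)).
  rewrite mem_rcons inE => /orP[/eqP ->|xs].
    exact: (add_ideal_mem _ (@ideal_gen_ideal _)).
  apply: sub_add_ideal; exact: ideal_gen_mem.
apply: add_ideal_sub; first exact: ideal_gen_ideal.
  apply: ideal_gen_sub => [|x xs]; first exact: ideal_gen_ideal.
  by apply: ideal_gen_mem; rewrite mem_rcons inE xs orbT.
by apply: ideal_gen_mem; rewrite mem_rcons inE eqxx.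
Qed.

Definition colon I u : set R := [set x | I (x * u)].

Lemma colon_ideal I u : is_ideal I -> is_ideal (colon I u).
Proof.
move=> iI; rewrite /colon; split=> /= [|x y|c x]; first by rewrite mul0r; exact: id0.
  by rewrite mulrDl; exact: idD.
by rewrite -mulrA; exact: idMl.
Qed.

Definition regular_mod I x := forall c, I (x * c) -> I c.

Lemma noetherianP : noetherian R <->
  forall I, is_ideal I -> exists s, I = ideal_gen s.
Proof.
split=> [nR I iI|H I].
  have [I1|I1] := pselect (I 1).
    exists [:: 1]; apply/seteqP; split=> x _; last by rewrite -(mulr1 x); exact: idMl.
    rewrite -(mulr1 x); apply: idMl; first exact: ideal_gen_ideal.
    by apply: ideal_gen_mem; exact: mem_head.
  have [J HJ] := is_ideal_idealr iI I1.
  have [s Hs] := nR J; exists s; apply/seteqP; split=> x.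
    by move/HJ/Hs.
  by move/Hs/HJ.
have [s Hs] := H _ (idealr_is_ideal I).
by exists s => x; rewrite -Hs.
Qed.

(** Without a maximal member, choice yields a strictly ascending sequence in [F]. Its union is an
    ideal whose finitely many generators already lie in one term, which stops the sequence. *)
Lemma noetherian_max (F : set (set R)) I0 : noetherian R ->
  (forall I, F I -> is_ideal I) -> F I0 ->
  exists2 I, F I & forall J, F J -> I `<=` J -> J `<=` I.
Proof.
move=> /noetherianP nR Fid F0; apply: contrapT => nmax.
have step I : exists J, F I -> [/\ F J, I `<=` J & ~ J `<=` I].
  have [FI|FI] := pselect (F I); last by exists I.
  apply: contrapT => nJ; apply: nmax; exists I => // J FJ IJ.
  by apply: contrapT => JI; apply: nJ; exists J.
have [f Hf] := choice step.
pose It n := iter n f I0.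
have FIt n : F (It n) by elim: n => //= n /Hf[].
have ItS n : It n `<=` It n.+1 by have [] := Hf _ (FIt n).
have Itle m n : (m <= n)%N -> It m `<=` It n.
  move=> /subnKC <-; elim: (n - m)%N => [|k IH]; first by rewrite addn0.
  by rewrite addnS; apply: subset_trans (ItS _).
pose U : set R := \bigcup_n It n.
have iU : is_ideal U.
  split=> [|x y [m _ Im] [n _ In]|c x [m _ Im]].
  - by exists 0%N => //; apply: id0; exact/Fid/FIt.
  - exists (maxn m n) => //; apply: idD; first exact/Fid/FIt.
      exact: Itle (leq_maxl _ _) _ Im.
    exact: Itle (leq_maxr _ _) _ In.
  - by exists m => //; apply: idMl => //; apply/Fid/FIt.
have [s Us] := nR U iU.
have [n sn] : exists n, forall x, x \in s -> It n x.
  have : forall x, x \in s -> U x by rewrite Us => x; exact: ideal_gen_mem.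
  elim: s {Us} => [|y s IH] sU; first by exists 0%N.
  have [|n Hn] := IH; first by move=> x xs; apply: sU; rewrite inE xs orbT.
  have [|m _ Hm] := sU y; first exact: mem_head.
  exists (maxn m n) => x; rewrite inE => /orP[/eqP ->|xs].
    exact: Itle (leq_maxl _ _) _ Hm.
  exact: Itle (leq_maxr _ _) _ (Hn x xs).
have [_ _] := Hf _ (FIt n); apply => x Ix.
have : U x by exists n.+1.
by rewrite Us; apply: ideal_gen_sub => //; exact/Fid/FIt.
Qed.

(** If x y kills v modulo I but y does not, then y v is outside I and its annihilator contains that
    of v. By maximality the two agree, so x kills v. *)
Lemma maximal_annihilator_prime I v : is_ideal I -> ~ I v ->
  (forall w, ~ I w -> colon I v `<=` colon I w -> colon I w `<=` colon I v) ->
  is_prime (colon I v).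
Proof.
move=> iI Iv vmax; split; first exact: colon_ideal; first by rewrite /colon /= mul1r.
move=> x y Ixy; have [Iy|Iy] := pselect (colon I v y); [by right|left].
apply: (vmax (y * v)) => //.
  by move=> z; rewrite /colon /= mulrCA => Iz; exact: idMl.
by move: Ixy; rewrite /colon /= mulrA.
Qed.

Lemma annihilator_sub_maximal I u : noetherian R -> is_ideal I -> ~ I u ->
  exists v, [/\ ~ I v, colon I u `<=` colon I v &
    forall w, ~ I w -> colon I v `<=` colon I w -> colon I w `<=` colon I v].
Proof.
move=> nR iI Iu.
pose F := [set K | exists v, [/\ ~ I v, colon I u `<=` colon I v & K = colon I v]].
have [||K [v [Iv uv ->]] vmax] := @noetherian_max F (colon I u) nR.
- by move=> K [v [_ _ ->]]; exact: colon_ideal.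
- by exists u; split.
exists v; split=> // w Iw vw; apply: vmax => //; exists w; split=> //.
exact: subset_trans vw.
Qed.

Lemma associated_prime I J u : noetherian R -> is_ideal I -> ~ I u ->
  J `<=` colon I u ->
  exists P v, [/\ is_prime P, J `<=` P, ~ I v & P `<=` colon I v].
Proof.
move=> nR iI Iu Ju; have [v [Iv uv vmax]] := annihilator_sub_maximal nR iI Iu.
exists (colon I v), v; split=> //; first exact: maximal_annihilator_prime.
exact: subset_trans uv.
Qed.

(** For such v the ideal [colon I v] is maximal among the annihilators of nonzero elements of R/I,
    hence an associated prime. *)
Definition maximal_ann I v := ~ I v /\
  forall w, ~ I w -> colon I v `<=` colon I w -> colon I w `<=` colon I v.

Lemma prod_in (T : eqType) (s : seq T) (f : T -> R) (P : set R) t :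
  is_ideal P -> t \in s -> P (f t) -> P (\prod_(i <- s) f i).
Proof.
move=> iP ts Pf; rewrite (big_rem t) //=; exact: idMr.
Qed.

Lemma prod_notin (T : eqType) (s : seq T) (f : T -> R) (P : set R) :
  is_prime P -> (forall t, t \in s -> ~ P (f t)) -> ~ P (\prod_(i <- s) f i).
Proof.
move=> [iP P1 PM]; elim: s => [|a s IH] H; first by rewrite big_nil.
rewrite big_cons => /PM[]; first by apply: H; exact: mem_head.
by apply: IH => t ts; apply: H; rewrite inE ts orbT.
Qed.

(* Prime avoidance; the maximality of the annihilators replaces the usual
   assumption that the primes are pairwise incomparable. *)
Lemma avoid_maximal_ann I J (s : seq R) : is_ideal I -> is_ideal J ->
  (forall v, v \in s -> maximal_ann I v) ->
  (forall v, v \in s -> ~ J `<=` colon I v) ->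
  exists2 z, J z & forall v, v \in s -> ~ colon I v z.
Proof.
move=> iI iJ; elim: s => [|v s IH] smax sJ; first by exists 0 => //; exact: id0.
have [||z Jz Hz] := IH.
- by move=> w ws; apply: smax; rewrite inE ws orbT.
- by move=> w ws; apply: sJ; rewrite inE ws orbT.
have [vz|vz] := pselect (colon I v z); last first.
  by exists z => // w; rewrite inE => /orP[/eqP -> //|]; exact: Hz.
have mv : maximal_ann I v by apply: smax; exact: mem_head.
have pv : is_prime (colon I v).
  by case: mv => ? ?; exact: maximal_annihilator_prime.
(* Otherwise [colon I w] lies in [colon I v], maximality makes them equal, and z, which lies in the
   second, would lie in the first. *)
have H w : exists y, w \in s -> colon I w y /\ ~ colon I v y.
  have [ws|ws] := boolP (w \in s); last by exists 0.
  apply: contrapT => ny; apply: (Hz w ws).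
  have wv : colon I w `<=` colon I v.
    by move=> y wy; apply: contrapT => vy; apply: ny; exists y.
  have [Iw wmax] : maximal_ann I w by apply: smax; rewrite inE ws orbT.
  exact: (wmax v mv.1 wv).
have [f Hf] := choice H.
have [j [Jj vj]] : exists j, J j /\ ~ colon I v j.
  apply: contrapT => nj; apply: (sJ v (mem_head _ _)) => y Jy.
  by apply: contrapT => vy; apply: nj; exists y.
(* y lies in J and in every [colon I w] with w in s, but not in the prime [colon I v], which
   contains z; so z + y avoids them all. *)
pose y := j * \prod_(w <- s) f w.
exists (z + y); first by apply: idD => //; exact: idMr.
move=> w; rewrite inE => /orP[/eqP ->|ws].
  rewrite addrC => /(idDr (colon_ideal v iI) vz).
  have [_ _ pM] := pv; move/pM => [//|].
  by apply: prod_notin => // t ts; have [] := Hf t ts.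
have iw := colon_ideal w iI.
have wy : colon I w y.
  by apply: idMl => //; apply: (prod_in iw ws); have [] := Hf w ws.
by move/(idDr iw wy) => Hw; exact: (Hz w ws).
Qed.

(** Finitely many associated primes suffice: let s generate a largest ideal among those generated by
    finite lists of elements with maximal annihilator. Each maximal annihilator is then [colon I w]
    for some w in s, and prime avoidance finds an element of J outside all of them. *)
Lemma exists_regular_mod I J : noetherian R -> is_ideal I -> is_ideal J ->
  (forall v, ~ I v -> ~ J `<=` colon I v) -> exists2 z, J z & regular_mod I z.
Proof.
move=> nR iI iJ HJ.
pose F := [set K | exists s : seq R, (forall v, v \in s -> maximal_ann I v) /\ K = ideal_gen s].
have [||K [s [smax ->]] Kmax] := @noetherian_max F (ideal_gen [::]) nR.
- by move=> K [s [_ ->]]; exact: ideal_gen_ideal.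
- by exists [::].
have [|z Jz Hz] := avoid_maximal_ann iI iJ smax.
  by move=> v vs; apply: HJ; have [] := smax v vs.
exists z => // c Izc; apply: contrapT => Ic.
have [v [Iv cv vmax]] := annihilator_sub_maximal nR iI Ic.
have pv := maximal_annihilator_prime iI Iv vmax.
have vs : ideal_gen s v.
  have /Kmax H : F (ideal_gen (rcons s v)).
    exists (rcons s v); split=> // w; rewrite mem_rcons inE => /orP[/eqP ->|]//.
    exact: smax.
  by apply: H; rewrite ideal_gen_rcons; [exact: sub_add_ideal|exact: (add_ideal_mem _ (@ideal_gen_ideal _))].
suff [w ws wv] : exists2 w, w \in s & colon I w `<=` colon I v.
  have [Iw wmax] := smax w ws.
  by apply: (Hz w ws); apply: (wmax v Iv wv); apply: cv.
apply: contrapT => nw.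
have H w : exists y, w \in s -> colon I w y /\ ~ colon I v y.
  have [ws|ws] := boolP (w \in s); last by exists 0.
  apply: contrapT => ny; apply: nw; exists w => // y wy.
  by apply: contrapT => vy; apply: ny; exists y.
have [f Hf] := choice H.
(* The product kills every member of s modulo I, hence also their combination v, although none of
   its factors lies in the prime [colon I v]. *)
suff : colon I v (\prod_(w <- s) f w).
  by apply: (prod_notin pv) => t ts; have [] := Hf t ts.
case: vs => d ->; rewrite /colon /= mulr_sumr; apply: id_sum => // i _.
rewrite mulrCA; apply: idMl => //.
have ii := colon_ideal s`_i iI.
apply: (prod_in ii (mem_nth 0 (ltn_ord i))).
by have [] := Hf _ (mem_nth 0 (ltn_ord i)).
Qed.

(** Only indices up to n matter; indexing by [nat] lets chains be prolonged and truncated without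
    casts between ordinals. *)
Definition chain n (p : nat -> set R) :=
  (forall i, (i <= n)%N -> is_prime (p i)) /\
  (forall i, (i < n)%N -> p i `<=` p i.+1 /\ exists2 x, p i.+1 x & ~ p i x).

Lemma chain_cons n p P Q : chain n p -> p 0%N = Q -> is_prime P -> P `<=` Q ->
  (exists2 x, Q x & ~ P x) -> exists2 q, chain n.+1 q & q 0%N = P.
Proof.
move=> [p1 p2] p0 pP PQ xPQ; exists (fun i => if i is j.+1 then p j else P) => //.
split=> -[|i] //= ilen; [exact: (p1 _ ilen)|by rewrite p0|exact: (p2 _ ilen)].
Qed.

Lemma chain_rcons n p P Q : chain n p -> p n = Q -> is_prime P -> Q `<=` P ->
  (exists2 x, P x & ~ Q x) -> exists2 q, chain n.+1 q & q n.+1 = P.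
Proof.
move=> [p1 p2] pn pP QP xPQ.
exists (fun i => if (i <= n)%N then p i else P); last by rewrite ltnn.
split=> i; first by case: (leqP i n) => // h _; exact: p1.
rewrite ltnS => ilen; rewrite ilen ltn_neqAle ilen andbT.
have [->|ne] := eqVneq i n; first by rewrite pn.
by apply: p2; rewrite ltn_neqAle ne.
Qed.

Lemma chain_trunc n m p : chain n p -> (m <= n)%N -> chain m p.
Proof.
move=> [p1 p2] mn; split=> i im; first exact: (p1 _ (leq_trans im mn)).
exact: (p2 _ (leq_trans im mn)).
Qed.

Lemma chain_sub n p i j : chain n p -> (i <= j <= n)%N -> p i `<=` p j.
Proof.
move=> [p1 p2] /andP[/subnKC <-]; elim: (j - i)%N => [|k IH]; first by rewrite addn0 => _ x.
rewrite addnS => h; apply: subset_trans (IH (ltnW h)) _.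
by have [] := p2 _ h.
Qed.

Lemma prime_chainP n : prime_chain R n <-> exists p, chain n p.
Proof.
split=> [[p Hp]|[p cp]].
  exists (fun i => [set x | x \in p (inord i)]); split=> i ilen.
    exact: prime_idealr_is_prime.
  have [|sub nsub] := Hp (inord i) (inord i.+1).
    by rewrite !inordK // ltnS ltnW.
  split=> //; apply: contrapT => H; apply: nsub => x px.
  by apply: contrapT => nx; apply: H; exists x.
have H (i : 'I_n.+1) : exists J : prime_idealr R, forall x, x \in J <-> p i x.
  by apply: is_prime_prime_idealr; apply: cp.1; rewrite -ltnS.
have [q Hq] := choice H; exists q => i j ij; split.
  move=> x /Hq px; apply/Hq; apply: (chain_sub cp _ px).
  by rewrite ltnW //= -ltnS.
move=> sub; have := cp.2 i (leq_trans ij (leq_ord j)).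
move=> [_ [x px npx]]; apply: npx; apply/Hq/sub/Hq.
by apply: (chain_sub cp _ px); rewrite ij /= -ltnS.
Qed.

(** Take P maximal among the ideals over I that miss S. For x, y outside P both P + (x) and P + (y)
    meet S; if x y were in P, the product of the two elements found would lie in P and in S. *)
Lemma exists_prime_disjoint I (S : set R) : noetherian R -> is_ideal I ->
  S 1 -> (forall x y, S x -> S y -> S (x * y)) -> (forall x, S x -> ~ I x) ->
  exists P, [/\ is_prime P, I `<=` P & forall x, S x -> ~ P x].
Proof.
move=> nR iI S1 SM SI.
pose F := [set K | [/\ is_ideal K, I `<=` K & forall x, S x -> ~ K x]].
have [||P [iP IP SP] Pmax] := @noetherian_max F I nR; [by move=> K []|by split|].
exists P; split=> //; split=> //; first exact: SP.
move=> x y Pxy; apply: contrapT => /not_orP[Px Py].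
have H z : ~ P z -> exists2 s, S s & add_ideal P z s.
  move=> Pz; apply: contrapT => ns; apply: Pz.
  apply: (Pmax (add_ideal P z)); last exact: add_ideal_mem.
    split; first exact: add_ideal_ideal.
      by apply: subset_trans IP _; exact: sub_add_ideal.
    by move=> s Ss Ps; apply: ns; exists s.
  exact: sub_add_ideal.
have [s Ss [i [c [Pi sE]]]] := H x Px.
have [t St [j [d [Pj tE]]]] := H y Py.
apply: (SP _ (SM _ _ Ss St)); rewrite sE mulrDl; apply: idD => //.
  exact: idMr.
rewrite tE mulrDr; apply: idD => //; first exact: idMl.
by rewrite mulrACA; exact: idMl.
Qed.

(* Multiplying the complement of a prime Q by the powers of x yields a
   multiplicative set that misses I when x is regular modulo I; a prime that
   contains I and misses this set lies strictly below Q when x is in Q. *)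
Lemma chain_below (I : nat -> set R) (x : nat -> R) n M : noetherian R ->
  (forall j, is_ideal (I j)) ->
  (forall j, (j < n)%N -> [/\ I j `<=` I j.+1, I j.+1 (x j) & regular_mod (I j) (x j)]) ->
  is_prime M -> I n `<=` M -> exists2 p, chain n p & p n = M.
Proof.
move=> nR iI; elim: n M => [|n IH] M HI pM IM.
  by exists (fun=> M) => //; split.
have [sub xI reg] := HI n (ltnSn n).
have [iM M1 MM] := pM.
pose S := [set y | exists (s : R) k, ~ M s /\ y = s * x n ^+ k].
have [|||Q [pQ IQ SQ]] := @exists_prime_disjoint (I n) S nR (iI n).
- by exists 1, 0%N; rewrite mul1r.
- move=> _ _ [s [k [Ms ->]]] [t [l [Mt ->]]]; exists (s * t), (k + l)%N.
  by rewrite exprD mulrACA; split=> // /MM[].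
- move=> _ [s [k [Ms ->]]]; rewrite mulrC.
  elim: k => [|k IHk]; first by rewrite mul1r => /sub/IM.
  by rewrite exprS -mulrA => /reg.
have QM : Q `<=` M.
  move=> y Qy; apply: contrapT => My; apply: SQ Qy.
  by exists y, 0%N; rewrite mulr1.
have [|p cp pn] := IH Q _ pQ IQ.
  by move=> j jn; apply: HI; exact: ltnW.
apply: (chain_rcons cp pn pM QM); exists (x n); first exact: IM.
by apply: SQ; exists 1, 1%N; rewrite mul1r expr1.
Qed.

End Ideals.

(** * Chains of primes above associated primes in local rings *)

Section LocalRing.
Variables (R : comNzRingType) (nR : noetherian R) (m : set R).
Hypotheses (pm : is_prime m) (m_local : forall I, is_ideal I -> ~ I 1 -> I `<=` m).
Implicit Types (I J P Q U : set R) (s : seq R).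

Lemma one_sub_unit x : m x -> exists y, y * (1 - x) = 1.
Proof.
move=> mx; apply: contrapT => H.
have nI : ~ add_ideal [set 0] (1 - x) 1.
  by move=> [_ [c [/= -> E]]]; apply: H; exists c; rewrite [RHS]E add0r.
have [im m1 _] := pm; apply: m1; rewrite -(subrK x 1); apply: idD => //.
have i0 := @zero_ideal R.
exact: (m_local (add_ideal_ideal (1 - x) i0) nI (add_ideal_mem _ i0)).
Qed.

(** [U] is a bare set, so finite generation gives way to a choice of w in U outside I with I + (w)
    maximal. Writing w = i + y w', maximality gives w' = j + c w, so (1 - c y) w' lies in I, and 1 -
    c y is a unit. *)
Lemma nakayama I U y : is_ideal I -> m y ->
  (forall w, U w -> exists i w', [/\ I i, U w' & w = i + y * w']) -> U `<=` I.
Proof.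
move=> iI my HU u0 Uu0; apply: contrapT => Iu0.
pose F := [set K | exists w, [/\ U w, ~ I w & K = add_ideal I w]].
have [||_ [w [Uw Iw ->]] wmax] := @noetherian_max R F (add_ideal I u0) nR.
- by move=> K [w [_ _ ->]]; exact: add_ideal_ideal.
- by exists u0; split.
have [i [w' [Ii Uw' wE]]] := HU w Uw.
have Iw' : ~ I w' by move=> H; apply: Iw; rewrite wE; apply: idD => //; exact: idMl.
have /wmax H : F (add_ideal I w') by exists w'.
have [j [c [Ij w'E]]] : add_ideal I w w'.
  apply: H; last exact: add_ideal_mem.
  apply: add_ideal_sub; [exact: add_ideal_ideal|exact: sub_add_ideal|].
  by exists i, y; split.
have [im _ _] := pm.
have [z zE] := @one_sub_unit (c * y) (idMl c im my).
apply: Iw'; rewrite -(mul1r w') -zE -mulrA mulrBl mul1r.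
apply: idMl => //; rewrite {1}w'E wE mulrDr mulrA addrA addrK.
by apply: idD => //; exact: idMl.
Qed.

(** If x w is in I, then w = i + d y with i in I, and cancelling y gives x d in I. So modulo I each
    element killed by x is y times another one, and Nakayama's lemma applies. *)
Lemma regular_swapl I x y : is_ideal I -> m y -> regular_mod I y ->
  regular_mod (add_ideal I y) x -> regular_mod I x.
Proof.
move=> iI my ry rx.
apply: (@nakayama I [set c | I (x * c)] y) => //= w Ixw.
have [i [d [Ii wE]]] : add_ideal I y w by apply: rx; exact: sub_add_ideal.
exists i, d; split=> //; last by rewrite mulrC.
apply: ry; move: Ixw; rewrite wE mulrDr [d * y]mulrC mulrCA addrC.
by apply: idDr => //; exact: idMl.
Qed.

(** From y c = i + d x one gets d = j + e y with j in I, and then y (c - e x) lies in I. Together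
    with [regular_swapl] this permutes the regular sequence y, x. *)
Lemma regular_swapr I x y : is_ideal I -> regular_mod I y ->
  regular_mod (add_ideal I y) x -> regular_mod (add_ideal I x) y.
Proof.
move=> iI ry rx c [i [d [Ii E]]].
have [j [e [Ij dE]]] : add_ideal I y d.
  apply: rx; exists (- i), c; split; first exact: idN.
  by rewrite [c * y]mulrC E addrA addNr add0r mulrC.
exists (c - e * x), e; split; last by rewrite subrK.
apply: ry; rewrite mulrBr E dE mulrDl.
have -> : i + (j * x + e * y * x) - y * (e * x) = i + j * x by ring.
by apply: idD => //; exact: idMr.
Qed.

(** Growing the ideal along the list matches the inductions on sequences, where the head y is
    absorbed into I. *)
Fixpoint regular_on I (ys : seq R) : Prop :=
  if ys is y :: ys' then
    [/\ m y, regular_mod I y & regular_on (add_ideal I y) ys']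
  else True.

(** If every element killed by P modulo I lay in I + (y), cancelling y would make it, modulo I, y
    times another such element; by Nakayama's lemma all of them would lie in I. *)
Lemma colon_escape I P y : is_ideal I -> m y -> regular_mod I y ->
  (exists2 u, ~ I u & P `<=` colon I u) ->
  exists2 w, P `<=` colon I w & ~ add_ideal I y w.
Proof.
move=> iI my ry [u Iu Pu]; apply: contrapT => H; apply: Iu.
apply: (@nakayama I [set w | P `<=` colon I w] y) => //= w Pw.
have [i [d [Ii wE]]] : add_ideal I y w.
  by apply: contrapT => nw; apply: H; exists w.
exists i, d; split=> //; last by rewrite mulrC.
move=> p Pp; apply: ry; have := Pw p Pp; rewrite /colon /= wE mulrDr addrC.
rewrite [d * y]mulrC mulrCA.
by apply: idDr => //; exact: idMl.
Qed.

Lemma add_ideal_colon_sub I P y w : is_ideal I -> P `<=` colon I w ->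
  add_ideal P y `<=` colon (add_ideal I y) w.
Proof.
move=> iI Pw _ [p [c [Pp ->]]]; exists (p * w), (c * w); split; first exact: Pw.
by rewrite mulrDl mulrAC.
Qed.

(* By Nakayama's lemma some element killed by P modulo I survives modulo
   I + (y), so a prime over P + (y) is associated to R/(I + (y)). *)
Lemma chain_above I ys P : is_ideal I -> regular_on I ys -> is_prime P ->
  (exists2 u, ~ I u & P `<=` colon I u) ->
  exists2 p, chain (size ys) p & p 0%N = P.
Proof.
elim: ys I P => [|y ys IH] I P iI; first by exists (fun=> P).
move=> [my ry rys] pP Pu.
have [w Pw nw] := colon_escape iI my ry Pu.
have iIy := add_ideal_ideal y iI.
have [Q [v [pQ PQ Iv Qv]]] :=
  associated_prime nR iIy nw (@add_ideal_colon_sub _ P y _ iI Pw).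
have [p cp p0] := IH _ Q iIy rys pQ (ex_intro2 _ _ v Iv Qv).
have [iP _ _] := pP.
apply: (chain_cons cp p0 pP); first by apply: subset_trans PQ; exact: sub_add_ideal.
exists y; first exact: (PQ _ (add_ideal_mem _ iP)).
case: Pu => u Iu Pu Py; apply: Iu; apply: ry; exact: Pu.
Qed.

(** Elementwise form of the isomorphisms Hom(R/P, R/(I + (x))) = Ext^1(R/P, R/I) = Hom(R/P, R/(I +
    (y))): as y u = v x modulo I for some v, the class of u goes to that of v. *)
Lemma colon_transfer I P x y u : is_ideal I -> regular_mod I x -> 
  regular_mod I y -> P x -> P y ->
  ~ add_ideal I x u -> P `<=` colon (add_ideal I x) u ->
  exists2 v, ~ add_ideal I y v & P `<=` colon (add_ideal I y) v.
Proof.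
move=> iI rx ry Px Py nu Pu.
have [i [v [Ii E]]] := Pu y Py.
exists v.
  move=> [j [w [Ij vE]]]; apply: nu; exists (u - w * x), w; split; last by rewrite subrK.
  apply: ry; rewrite mulrBr E vE.
  have -> : i + (j + w * y) * x - y * (w * x) = i + j * x by ring.
  by apply: idD => //; exact: idMr.
move=> p Pp; have [j [c [Ij pE]]] := Pu p Pp.
exists (p * v - c * y), c; split; last by rewrite subrK.
apply: rx.
have Ep : p * (v * x) = y * (j + c * x) - p * i by rewrite -pE (mulrCA y) E; ring.
have -> : x * (p * v - c * y) = p * (v * x) - y * (c * x) by ring.
have -> : p * (v * x) - y * (c * x) = y * j - p * i by rewrite Ep; ring.
by apply: idB => //; exact: idMl.
Qed.

(* If y lies outside P, an element x' of P that is regular modulo I + (y) may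
   replace x; then y is regular modulo I + (x'), and one passes to I + (y). *)
Lemma chain_above_mod_regular I x ys P : is_ideal I -> regular_on I ys ->
  regular_mod I x -> is_prime P -> P x ->
  (exists2 u, ~ add_ideal I x u & P `<=` colon (add_ideal I x) u) ->
  exists2 p, chain (size ys).-1 p & p 0%N = P.
Proof.
elim: ys I x P => [|y ys IH] I x P iI; first by exists (fun=> P).
move=> [my ry rys] rx pP Px [u nu Pu] /=.
have [iP _ _] := pP; have iIy := add_ideal_ideal y iI.
have [Py|Py] := pselect (P y).
  by apply: chain_above iIy rys pP _; exact: colon_transfer nu Pu.
have [Hv|Hv] := pselect (exists2 v, ~ add_ideal I y v & P `<=` colon (add_ideal I y) v).
  exact: chain_above iIy rys pP Hv.
(* No element outside I + (y) is killed by P modulo I + (y), so prime avoidance gives x' in P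
   regular modulo I + (y). *)
have [|x' Px' rx'] := exists_regular_mod nR iIy iP.
  by move=> v nv Pv; apply: Hv; exists v.
(* With y alone the required length is 0, and P itself is the chain. *)
case: ys IH rys => [|z ys] IH rys; first by exists (fun=> P).
have rIx' := regular_swapl iI my ry rx'.
have rIy := regular_swapr iI ry rx'.
have iIx' := add_ideal_ideal x' iI.
have Hu' := colon_transfer iI rx rIx' Px Px' nu Pu.
have [w Pw nw] := colon_escape iIx' my rIy Hu'.
have iIyx' := add_ideal_ideal x' iIy.
have Pyw := @add_ideal_colon_sub _ P y _ iIx' Pw.
rewrite add_idealC in nw Pyw.
have [Q [v [pQ PQ Iv Qv]]] := associated_prime nR iIyx' nw Pyw.
have Qx' : Q x' by apply: PQ; exact: sub_add_ideal.
have [p cp p0] := IH _ x' Q iIy rys rx' pQ Qx' (ex_intro2 _ _ v Iv Qv).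
apply: (chain_cons cp p0 pP).
  by apply: subset_trans PQ; exact: sub_add_ideal.
exists y => //; apply: PQ; exact: add_ideal_mem.
Qed.

End LocalRing.

(** * Localization *)

Lemma regular_seq_regular_on (B : comNzRingType) (m : set B) (l : seq B) :
  regular_seq l -> (forall x, x \in l -> m x) -> regular_on m [set 0] l.
Proof.
move=> [Hreg _]; rewrite -ideal_gen_nil.
(* The prefix already absorbed into the ideal, here [[::]], is made a variable for the induction. *)
have : forall i, (size (@nil B) <= i < size ([::] ++ l))%N -> forall x,
   ideal_gen (take i ([::] ++ l)) (([::] ++ l)`_i * x) -> ideal_gen (take i ([::] ++ l)) x.
  by move=> i /andP[_]; exact: Hreg.
elim: l [::] {Hreg} => [//|y l IH] l1 Hreg lm /=; split.
- by apply: lm; exact: mem_head.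
- move=> c; have := Hreg (size l1) _ c; rewrite take_size_cat // nth_cat ltnn subnn /=.
  by apply; rewrite size_cat /= leqnn /= -{1}[size l1]addn0 ltn_add2l.
- rewrite -ideal_gen_rcons; apply: IH => [i Hi|x xl]; last first.
    by apply: lm; rewrite inE xl orbT.
  rewrite cat_rcons in Hi *; apply: Hreg.
  by case/andP: Hi; rewrite size_rcons => /ltnW -> ->.
Qed.

(** This bounds the depth by the dimension, and it also supplies the chain that attains the
    dimension. *)
Lemma regular_seq_chain (B : comNzRingType) (Q : set B) (l : seq B) : noetherian B ->
  regular_seq l -> is_prime Q -> (forall x, x \in l -> Q x) -> prime_chain B (size l).
Proof.
move=> nB [Hreg _] pQ lQ; apply/prime_chainP.
have [||||p cp _] := @chain_below B (fun j => ideal_gen (take j l)) (nth 0 l) (size l) Q nB.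
- by move=> j; exact: ideal_gen_ideal.
- move=> j jl; rewrite [take j.+1 l](take_nth 0) // ideal_gen_rcons; split.
  + exact: sub_add_ideal.
  + by apply: add_ideal_mem; exact: ideal_gen_ideal.
  + by move=> c; exact: Hreg.
- by [].
- by rewrite take_size; apply: ideal_gen_sub lQ; case: pQ.
by exists p.
Qed.

Section LocalizationTheory.
Variables (A : idomainType) (P : prime_idealr A).
Local Notation R := (localization P).
Implicit Types (I : set A) (a b s t : A) (x y : R).

Lemma tofrac_loc a : tofrac a \in loc_pred P.
Proof.
by apply/loc_predP; exists a, 1; rewrite idealr1 rmorph1 divr1.
Qed.

Definition loc_of a : R := exist (fun z => z \in loc_pred P) _ (tofrac_loc a).

Lemma loc_of_is_zmod_morphism : zmod_morphism loc_of.
Proof. by move=> a b; apply/val_inj; rewrite !raddfB /= rmorphB. Qed.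
Lemma loc_of_is_monoid_morphism : monoid_morphism loc_of.
Proof.
by split=> [|a b]; apply/val_inj; rewrite /= ?rmorph1 ?rmorphM.
Qed.
HB.instance Definition _ :=
  GRing.isZmodMorphism.Build A R loc_of loc_of_is_zmod_morphism.
HB.instance Definition _ :=
  GRing.isMonoidMorphism.Build A R loc_of loc_of_is_monoid_morphism.

Lemma loc_of_inj : injective loc_of.
Proof.
by move=> a b /(congr1 val) /= /eqP; rewrite -subr_eq0 -rmorphB tofrac_eq0 subr_eq0 => /eqP.
Qed.

Lemma loc_of_surj x : exists a s, s \notin P /\ loc_of s * x = loc_of a.
Proof.
have /loc_predP[a [s [sP xE]]] := valP x.
exists a, s; split=> //; apply/val_inj.
by rewrite rmorphM /= xE mulrC divfK // (notin_prime_neq0 sP).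
Qed.

Lemma loc_of_unit s : s \notin P -> exists x, loc_of s * x = 1.
Proof.
move=> sP; have H : (tofrac s)^-1 \in loc_pred P.
  by apply/loc_predP; exists 1, s; rewrite rmorph1 mul1r.
exists (exist (fun z => z \in loc_pred P) _ H); apply/val_inj; rewrite rmorphM rmorph1 /= divff //.
exact: notin_prime_neq0 sP.
Qed.

Definition loc_ideal I : set R :=
  [set x | exists a s, [/\ I a, s \notin P & loc_of s * x = loc_of a]].

Lemma notin_primeM s t : s \notin P -> t \notin P -> s * t \notin P.
Proof. by move=> sP tP; rewrite prime_idealrM negb_or sP. Qed.

Lemma loc_ideal_ideal I : is_ideal I -> is_ideal (loc_ideal I).
Proof.
move=> iI; split=> [|x y [a [s [Ia sP xE]]] [b [t [Ib tP yE]]]|c x [a [s [Ia sP xE]]]].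
- exists 0, 1; split; [exact: id0|by rewrite idealr1|by rewrite mulr0 rmorph0].
- exists (t * a + s * b), (s * t); split; last 1 first.
  + rewrite rmorphD !rmorphM /= -xE -yE; ring.
  + by apply: idD => //; exact: idMl.
  + exact: notin_primeM.
- have [b [t [tP cE]]] := loc_of_surj c.
  exists (b * a), (t * s); split; [exact: idMl|exact: notin_primeM|].
  by rewrite !rmorphM /= -cE -xE; ring.
Qed.

Lemma loc_ideal_of I a : I a -> loc_ideal I (loc_of a).
Proof.
by move=> Ia; exists a, 1; rewrite idealr1 rmorph1 mul1r.
Qed.

Lemma loc_ideal_ofP I a : is_ideal I -> loc_ideal I (loc_of a) ->
  exists2 s, s \notin P & I (s * a).
Proof.
by move=> iI [b [s [Ib sP]]]; rewrite -rmorphM => /loc_of_inj E; exists s; rewrite ?E.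
Qed.

Lemma loc_ideal_le I (J : set R) : is_ideal J ->
  (forall a, I a -> J (loc_of a)) -> loc_ideal I `<=` J.
Proof.
move=> iJ IJ x [a [s [Ia sP xE]]]; have [y yE] := loc_of_unit sP.
by rewrite -(mul1r x) -yE mulrAC xE; apply: idMr => //; exact: IJ.
Qed.

Lemma contract_ideal (J : set R) : is_ideal J -> is_ideal (loc_of @^-1` J).
Proof.
move=> iJ; rewrite /preimage; split=> /= [|a b|c a]; first by rewrite rmorph0; exact: id0.
  by rewrite rmorphD; exact: idD.
by rewrite rmorphM; exact: idMl.
Qed.

Lemma loc_contract (J : set R) : is_ideal J -> loc_ideal (loc_of @^-1` J) = J.
Proof.
move=> iJ; apply/seteqP; split; first exact: loc_ideal_le.
move=> x Jx; have [a [s [sP xE]]] := loc_of_surj x; exists a, s; split=> //.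
by rewrite /preimage /= -xE; exact: idMl.
Qed.

Lemma loc_ideal_gen (l : seq A) : loc_ideal (ideal_gen l) = ideal_gen (map loc_of l).
Proof.
apply/seteqP; split.
  apply: loc_ideal_le => [|a]; first exact: ideal_gen_ideal.
  have iJ := contract_ideal (@ideal_gen_ideal _ (map loc_of l)).
  apply: (ideal_gen_sub iJ) => b bl.
  by apply: ideal_gen_mem; exact: map_f.
apply: ideal_gen_sub => [|_ /mapP[a al ->]].
  by apply: loc_ideal_ideal; exact: ideal_gen_ideal.
by apply: loc_ideal_of; exact: ideal_gen_mem.
Qed.

Lemma loc_noetherian : noetherian A -> noetherian R.
Proof.
move=> /noetherianP nA; apply/noetherianP => J iJ.
have [l lE] := nA _ (contract_ideal iJ); exists (map loc_of l).
by rewrite -loc_ideal_gen -lE loc_contract.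
Qed.

Definition loc_max : set R := loc_ideal [set a | a \in P].

Lemma loc_max_of a : loc_max (loc_of a) <-> a \in P.
Proof.
split=> [/(loc_ideal_ofP (idealr_is_ideal P))[s sP] /=|]; last exact: loc_ideal_of.
by rewrite prime_idealrM (negPf sP).
Qed.

Lemma loc_max_prime : is_prime loc_max.
Proof.
split; [by apply: loc_ideal_ideal; exact: idealr_is_ideal| |].
  by rewrite -(rmorph1 loc_of) loc_max_of idealr1.
have iM : is_ideal loc_max by apply: loc_ideal_ideal; exact: idealr_is_ideal.
move=> x y Mxy; have [a [s [sP xE]]] := loc_of_surj x.
have [b [t [tP yE]]] := loc_of_surj y.
have /loc_max_of : loc_max (loc_of (a * b)).
  by rewrite rmorphM /= -xE -yE mulrACA; exact: idMl.
by rewrite prime_idealrM => /orP[aP|bP]; [left; exists a, s|right; exists b, t].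
Qed.

Lemma loc_max_local (J : set R) : is_ideal J -> ~ J 1 -> J `<=` loc_max.
Proof.
move=> iJ J1 x Jx; have [a [s [sP xE]]] := loc_of_surj x.
exists a, s; split=> //=; apply: contraT => aP; exfalso; apply: J1.
have [y <-] := loc_of_unit aP; rewrite -xE; apply: idMr => //; exact: idMl.
Qed.

Lemma loc_regular I a : is_ideal I -> regular_mod I a ->
  regular_mod (loc_ideal I) (loc_of a).
Proof.
move=> iI ra c [b [s [Ib sP E]]]; have [d [t [tP cE]]] := loc_of_surj c.
exists (s * d), (s * t); split; [|exact: notin_primeM|].
  apply: ra; suff -> : a * (s * d) = t * b by exact: idMl.
  by apply: loc_of_inj; rewrite !rmorphM /= -cE -E; ring.
by rewrite !rmorphM /= -cE mulrA.
Qed.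

(** The depth is at most the dimension because regular sequences give chains. Here [l] bounds the
    depth from below and the last hypothesis bounds the dimension from above by the same number. *)
Lemma cohen_macaulay_local_intro (l : seq A) : noetherian A ->
  (forall i, (i < size l)%N -> regular_mod (ideal_gen (take i l)) l`_i) ->
  {subset l <= P} -> (forall n, prime_chain R n -> (n <= size l)%N) ->
  cohen_macaulay_local R.
Proof.
move=> nA Hreg lP Hdim; have nR := loc_noetherian nA; split=> //.
have [iM M1 _] := loc_max_prime.
have [M HM] := is_ideal_idealr iM M1.
have sM : forall x, x \in map loc_of l -> loc_max x.
  by move=> _ /mapP[a al ->]; apply/loc_max_of; exact: lP.
have rl : regular_seq (map loc_of l).
  split=> [i|H1]; last by apply: M1; apply: (ideal_gen_sub iM sM).
  rewrite size_map => il x; rewrite (nth_map 0) // -map_take -loc_ideal_gen.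
  by apply: loc_regular; [exact: ideal_gen_ideal|exact: Hreg].
exists M; split.
  move=> J x xJ; apply/HM; apply: (loc_max_local (idealr_is_ideal J)) xJ.
  by rewrite /= idealr1.
exists (size l); split; split=> //.
- by rewrite -(size_map loc_of); exact: (regular_seq_chain nR rl loc_max_prime sM).
- exists (map loc_of l); split=> //; last by rewrite size_map.
  by move=> x /sM ?; apply/HM.
- move=> s rs sM'; apply: Hdim; apply: regular_seq_chain nR rs loc_max_prime _.
  by move=> x /sM' /HM.
Qed.

Lemma cohen_macaulay_local_elim n : cohen_macaulay_local R -> prime_chain R n ->
  exists ys : seq R, regular_on loc_max [set 0] ys /\ (n <= size ys)%N.
Proof.
move=> [nR [M [lM [d [[_ dmax] [[ys [rys ysM szys]] _]]]]]] cn.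
exists ys; split; last by rewrite szys; exact: dmax.
apply: regular_seq_regular_on rys _ => x /ysM xM.
by apply: (loc_max_local (idealr_is_ideal M)) xM; rewrite /= idealr1.
Qed.

End LocalizationTheory.

(** * Semigroup algebras are noetherian *)

(** Choose repeatedly, past the last chosen index, an index where v is least among all remaining
    ones. *)
Lemma nondecreasing_subsequence (v : nat -> nat) : exists psi : nat -> nat,
  forall i j, (i < j)%N -> (psi i < psi j)%N /\ (v (psi i) <= v (psi j))%N.
Proof.
have H a : exists b, (a <= b)%N /\ forall c, (a <= c)%N -> (v b <= v c)%N.
  have ex : exists d, `[< exists2 b, (a <= b)%N & v b = d >].
    by exists (v a); apply/asboolP; exists a.
  case: (ex_minnP ex) => d /asboolP[b ab <-] dmin; exists b; split=> // c ac.
  by apply: dmin; apply/asboolP; exists c.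
have [f Hf] := choice H.
pose psi := fix psi i := if i is j.+1 then f (psi j).+1 else f 0%N.
have Hv i c : (psi i <= c)%N -> (v (psi i) <= v c)%N.
  case: i => [|i] /= ic; first by have [_ h] := Hf 0%N; exact: h.
  by have [le h] := Hf (psi i).+1; apply: h; exact: leq_trans le ic.
have Hpsi i : (psi i < psi i.+1)%N by have [] := Hf (psi i).+1.
exists psi => i j ij.
have lt : (psi i < psi j)%N.
  elim: j ij => // j IH; rewrite ltnS leq_eqVlt => /orP[/eqP ->|/IH]; first exact: Hpsi.
  by move=> h; exact: ltn_trans h (Hpsi j).
by split=> //; apply: Hv; exact: ltnW.
Qed.

(** Dickson's lemma: a nondecreasing subsequence is extracted for one coordinate after the other. *)
Lemma dickson k (u : nat -> nat -> nat) :
  exists i j, (i < j)%N /\ forall l, (l < k)%N -> (u i l <= u j l)%N.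
Proof.
suff [phi H] : exists phi : nat -> nat, forall i j, (i < j)%N ->
    (phi i < phi j)%N /\ forall l, (l < k)%N -> (u (phi i) l <= u (phi j) l)%N.
  by exists (phi 0%N), (phi 1%N); exact: H.
elim: k => [|k [phi H]]; first by exists id.
have [psi Hpsi] := nondecreasing_subsequence (fun i => u (phi i) k).
exists (phi \o psi) => i j /Hpsi[lt le]; have [lt' le'] := H _ _ lt.
split=> // l; rewrite ltnS leq_eqVlt => /orP[/eqP ->//|]; exact: le'.
Qed.

(** An ideal that is not finitely generated yields the forbidden sequence: each term is [ord]-least
    among the elements of the ideal outside what the earlier terms generate. *)
Lemma noetherian_of_sequences (A : comNzRingType) (ord : A -> A -> Prop) :
  (forall X : set A, X !=set0 -> exists2 g, X g & forall h, X h -> ord g h) ->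
  (forall (I : set A) (g : nat -> A), is_ideal I -> (forall k, I (g k)) ->
     (forall k h, I h -> ~ ideal_gen (mkseq g k) h -> ord (g k) h) ->
     (forall k, ~ ideal_gen (mkseq g k) (g k)) -> False) ->
  noetherian A.
Proof.
move=> minP H; apply/noetherianP => I iI; apply: contrapT => nI.
have step (s : seq A) : exists g, (forall x, x \in s -> I x) ->
    [/\ I g, ~ ideal_gen s g & forall h, I h -> ~ ideal_gen s h -> ord g h].
  have [sI|sI] := pselect (forall x, x \in s -> I x); last by exists 0.
  have [|g [Ig ng] gmin] := minP [set g | I g /\ ~ ideal_gen s g].
    apply: contrapT => H0; apply: nI; exists s; apply/seteqP; split.
      by move=> x Ix; apply: contrapT => nx; apply: H0; exists x.
    exact: ideal_gen_sub.
  by exists g => _; split=> // h Ih nh; exact: gmin.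
have [f Hf] := choice step.
pose st := fix st k := if k is j.+1 then rcons (st j) (f (st j)) else [::].
pose g k := f (st k).
have stE k : st k = mkseq g k.
  by elim: k => // k IH /=; rewrite mkseqS -IH.
have stI k : forall x, x \in st k -> I x.
  elim: k => // k IH x /=; rewrite mem_rcons inE => /orP[/eqP ->|]; last exact: IH.
  by have [] := Hf _ IH.
apply: (H I g iI) => [k|k h|k].
- by have [] := Hf _ (stI k).
- by rewrite -stE; have [_ _] := Hf _ (stI k); apply.
- by rewrite -stE; have [] := Hf _ (stI k).
Qed.

Section MonoidSpan.
Variable n : nat.
Implicit Types (s : seq 'X_{1..n}) (S : affine_semigroup n).

Lemma asg0 S : asg_set S 0%MM. Proof. by case: (asg_closed S). Qed.
Lemma asgD S u v : asg_set S u -> asg_set S v -> asg_set S (u + v)%MM.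
Proof. by case: (asg_closed S) => _; apply. Qed.
Lemma asgMn S u k : asg_set S u -> asg_set S (u *+ k)%MM.
Proof.
by move=> Su; elim: k => [|k IH]; rewrite ?mulm0n ?mulmS; [exact: asg0|exact: asgD].
Qed.
Lemma asg_sum S (T : Type) (r : seq T) (P : pred T) (F : T -> 'X_{1..n}) :
  (forall t, P t -> asg_set S (F t)) -> asg_set S (\sum_(t <- r | P t) F t)%MM.
Proof.
by move=> H; elim/big_ind: _ => //; [exact: asg0|move=> x y; exact: asgD].
Qed.

Lemma span_mem (G : set 'X_{1..n}) m : G m -> semigroup_span G m.
Proof. by move=> Gm X [_ GX]; exact: GX. Qed.

Lemma span_sub (G X : set 'X_{1..n}) : submonoid_closed X -> G `<=` X ->
  semigroup_span G `<=` X.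
Proof. by move=> cX GX m; apply. Qed.

Lemma span_seqP s m : semigroup_span [set` s] m ->
  exists c : nat -> nat, m = (\sum_(i < size s) nth 0%MM s i *+ c i)%MM.
Proof.
move: m; apply: span_sub.
  split=> [|u v [c ->] [d ->]]; first by exists (fun=> 0%N); rewrite big1.
  exists (fun i => c i + d i)%N; rewrite -big_split; apply: eq_bigr => i _ /=.
  by apply/mnmP => j; rewrite mnmDE !mulmnE mulnDr.
move=> m /= ms; have im : (index m s < size s)%N by rewrite index_mem.
exists (fun i => (i == index m s) : nat).
rewrite (bigD1 (Ordinal im)) //= eqxx mulm1n nth_index // big1 ?addm0 //.
by move=> i; rewrite -val_eqE /= => /negPf ->; rewrite mulm0n.
Qed.
End MonoidSpan.

Section SemigroupAlgebraTheory.
Variables (K : fieldType) (n : nat) (S : affine_semigroup n).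
Local Notation A := (semigroup_algebra K S).
Implicit Types (m : 'X_{1..n}) (c : K) (p q : A).

Lemma sga_const_subproof c : c%:MP_[n] \in sga_pred S.
Proof.
apply/sga_predP => m; rewrite msuppC; case: ifP => // _.
by rewrite inE => /eqP ->; exact: asg0.
Qed.

Definition sga_const c : A := exist (fun p : {mpoly K[n]} => p \in sga_pred S) _ (sga_const_subproof c).

Lemma sga_const_is_zmod_morphism : zmod_morphism sga_const.
Proof. by move=> a b; apply/val_inj; rewrite !raddfB /= mpolyCB. Qed.
Lemma sga_const_is_monoid_morphism : monoid_morphism sga_const.
Proof. by split=> [|a b]; apply/val_inj; rewrite ?rmorphM ?rmorph1 //= mpolyCM. Qed.
HB.instance Definition _ :=
  GRing.isZmodMorphism.Build K A sga_const sga_const_is_zmod_morphism.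
HB.instance Definition _ :=
  GRing.isMonoidMorphism.Build K A sga_const sga_const_is_monoid_morphism.

(* The junk value outside S is 0. *)
Definition monomial m : A := insubd (0 : A) ('X_[m] : {mpoly K[n]}).

Lemma val_monomial m : asg_set S m -> val (monomial m) = 'X_[m].
Proof.
move=> Sm; rewrite insubdK //; apply/sga_predP => m'.
by move/mem_msuppXP => <-.
Qed.

Lemma monomial0 : monomial 0 = 1.
Proof. by apply/val_inj; rewrite val_monomial ?mpolyX0 ?rmorph1 //; exact: asg0. Qed.

Lemma monomialD m m' : asg_set S m -> asg_set S m' -> monomial (m + m') = monomial m * monomial m'.
Proof.
move=> Sm Sm'; apply/val_inj; rewrite rmorphM /= !val_monomial ?mpolyXD //.
exact: asgD.
Qed.

Lemma msupp_asg p m : m \in msupp (val p) -> asg_set S m.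
Proof. by have /sga_predP := valP p; apply. Qed.

Lemma val_sga_constM c p : val (sga_const c * p) = c *: val p.
Proof. by rewrite rmorphM /= mul_mpolyC. Qed.

Lemma sga_expand p : p = \sum_(m <- msupp (val p)) sga_const (val p)@_m * monomial m.
Proof.
apply/val_inj; rewrite raddf_sum /= [LHS]mpolyE big_seq [RHS]big_seq.
by apply: eq_bigr => m /msupp_asg Sm; rewrite mul_mpolyC val_monomial.
Qed.

Lemma monomialM_coef m p k : asg_set S m -> (val (monomial m * p))@_(m + k) = (val p)@_k.
Proof. by move=> Sm; rewrite rmorphM /= val_monomial // mulrC mcoeffMX. Qed.

Lemma msupp_monomialM m p k : asg_set S m -> k \in msupp (val (monomial m * p)) ->
  exists2 k', k = (m + k')%MM & k' \in msupp (val p).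
Proof.
move=> Sm; rewrite rmorphM /= val_monomial // mulrC.
by rewrite (perm_mem (msuppMX _ _)) => /mapP[k' k'p ->]; exists k'; rewrite // addmC.
Qed.

(** Leading exponents are compared through their coefficients over generators of S, not
    componentwise: Dickson's lemma then gives i < j whose leading exponents differ by an element d
    of S. Subtracting a scalar multiple of the d-translate of g_i from g_j lowers the leading
    exponent without entering the ideal of the earlier terms, against minimality. *)
Lemma sga_noetherian : noetherian A.
Proof.
apply: (@noetherian_of_sequences _ (fun g h : A => (mlead (val g) <= mlead (val h))%O)).
  move=> X [x Xx]; apply: contrapT => nX.
  suff H m : forall g, X g -> mlead (val g) = m -> False by exact: (H _ _ Xx erefl).
  elim/(@ltmwf n): m => m IH g Xg gE; apply: nX; exists g => // h Xh.
  rewrite leNgt; apply/negP => lt; apply: (IH (mlead (val h)) _ h Xh erefl).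
  by rewrite -gE.
move=> I g iI Ig gmin ng.
have g0 k : val (g k) != 0.
  apply/eqP => E; apply: (ng k); have -> : g k = 0 by exact: val_inj.
  exact: (id0 (@ideal_gen_ideal _ _)).
have Sl k : asg_set S (mlead (val (g k))) by apply: (@msupp_asg (g k)); exact: mlead_supp.
have [s sE] := asg_fin_gen S.
have Hc k : exists c : nat -> nat, mlead (val (g k)) = (\sum_(i < size s) nth 0%MM s i *+ c i)%MM.
  by apply: span_seqP; rewrite -sE.
have [u Hu] := choice Hc.
have [i [j [ij le]]] := dickson (size s) u.
pose d := (\sum_(l < size s) nth 0%MM s l *+ (u j l - u i l))%MM.
have Sd : asg_set S d.
  apply: asg_sum => l _; apply: asgMn; rewrite sE; apply: span_mem => /=.
  exact: mem_nth.
have dE : mlead (val (g j)) = (d + mlead (val (g i)))%MM.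
  rewrite !Hu -big_split; apply: eq_bigr => l _ /=.
  by apply/mnmP => t; rewrite mnmDE !mulmnE -mulnDr subnK // le.
pose c := mleadc (val (g j)) / mleadc (val (g i)).
pose h := g j - sga_const c * (monomial d * g i).
have gi : ideal_gen (mkseq g j) (g i).
  by apply: ideal_gen_mem; apply/mapP; exists i; rewrite // mem_iota.
have nh : ~ ideal_gen (mkseq g j) h.
  move=> H; apply: (ng j); rewrite -(subrK (sga_const c * (monomial d * g i)) (g j)).
  have iJ := @ideal_gen_ideal _ (mkseq g j).
  by apply: idD => //; do 2!apply: idMl => //.
have Ih : I h by apply: idB => //; do 2!apply: idMl => //.
have := gmin j h Ih nh; rewrite leNgt => /negP; apply.
have hE : val h = val (g j) - c *: val (monomial d * g i).
  by rewrite -val_sga_constM -raddfB.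
have h0 : val h != 0.
  apply/eqP => E; apply: nh; have -> : h = 0 by exact: val_inj.
  exact: (id0 (@ideal_gen_ideal _ _)).
rewrite lt_neqAle; apply/andP; split.
  apply/eqP => E; have := mlead_supp h0; rewrite mcoeff_msupp E => /eqP; apply.
  rewrite hE mcoeffB mcoeffZ.
  rewrite [X in _ - c * X](_ : _ = mleadc (val (g i))).
    by rewrite /c divfK ?subrr // mleadc_eq0.
  by rewrite dE; exact: monomialM_coef.
have := mlead_supp h0; rewrite {2}hE => /msuppB_le.
rewrite mem_cat => /orP[/msupp_le_mlead//|].
move=> /msuppZ_le /(msupp_monomialM Sd)[k -> kg].
by rewrite dE lemc_add2r; exact: msupp_le_mlead.
Qed.

End SemigroupAlgebraTheory.

(** * Growth and the length of chains of primes *)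

(* Read the relation as a polynomial in x_0 over the others: dividing out the
   least power of x_0, which is not in p_0, and reducing modulo p_1, which
   contains x_0, leaves a relation between x_1, ..., x_{k-1} modulo p_1. *)
Lemma chain_independent (K : fieldType) (R : comNzRingType) (f : {rmorphism K -> R})
    k (p : nat -> set R) (x : nat -> R) (E : finType) (e : E -> nat -> nat) (c : E -> K) :
  chain k p -> (forall i, (i < k)%N -> p i.+1 (x i) /\ ~ p i (x i)) ->
  (forall a b, (forall i, (i < k)%N -> e a i = e b i) -> a = b) ->
  (exists a, c a != 0) ->
  ~ p 0%N (\sum_a f (c a) * \prod_(0 <= i < k) x i ^+ e a i).
Proof.
move=> [pp psub] xp einj [a0 ca0] H.
(* [T] collects the terms that survive j reductions: their exponents at x_0, ..., x_{j-1} agree, and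
   without these factors their sum lies in p_j. For j = k one term is left, a nonzero constant in
   p_k. *)
have step j : (j <= k)%N -> exists T : pred E,
   [/\ exists a, T a, forall a, T a -> c a != 0,
       forall a b i, (i < j)%N -> T a -> T b -> e a i = e b i &
       p j (\sum_(a | T a) f (c a) * \prod_(j <= i < k) x i ^+ e a i)].
  elim: j => [_|j IH jk].
    exists [pred a | c a != 0]; split => //; first by exists a0.
    move: H; rewrite (bigID [pred a | c a != 0]) /= addrC big1 ?add0r //.
    by move=> a /negPn/eqP ->; rewrite rmorph0 mul0r.
  have [T [[a1 Ta1] Tc Tagree HT]] := IH (ltnW jk).
  have [[im1 _ _] [xj nxj]] := (pp j.+1 jk, xp j jk).
  case: (arg_minnP (fun a => e a j) Ta1) => {a1 Ta1} a1 Ta1 amin.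
  exists [pred a | T a && (e a j == e a1 j)]; split=> /=.
  - by exists a1; rewrite Ta1 /=.
  - by move=> a /andP[/Tc].
  - move=> a b i; rewrite ltnS leq_eqVlt => /orP[/eqP -> /andP[_ /eqP ->] /andP[_ /eqP ->]//|ij].
    by move=> /andP[Ta _] /andP[Tb _]; exact: Tagree.
  have : p j (x j ^+ e a1 j * (\sum_(a | T a) f (c a) *
      (x j ^+ (e a j - e a1 j) * \prod_(j.+1 <= i < k) x i ^+ e a i))).
    rewrite mulr_sumr; move: HT; congr (p j _); apply: eq_bigr => a Ta.
    rewrite big_ltn // [RHS]mulrCA; congr (_ * _).
    by rewrite mulrA -exprD subnKC // amin.
  have [_ _ pM] := pp j (ltnW jk); move/pM => [/(prime_exp (pp j (ltnW jk)))//|].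
  move/((psub j jk).1); rewrite (bigID [pred a | e a j == e a1 j]) /= => pS.
  move: (pS); rewrite (eq_bigr (fun a => f (c a) * \prod_(j.+1 <= i < k) x i ^+ e a i)).
    apply: idDr => //; apply: id_sum => // a /andP[Ta ne].
    apply: idMl => //; apply: idMr => //.
    have -> : (e a j - e a1 j)%N = (e a j - e a1 j).-1.+1.
      by rewrite prednK // subn_gt0 ltn_neqAle eq_sym ne amin.
    by rewrite exprS; exact: idMr.
  by move=> a /andP[_ /eqP ->]; rewrite subnn mul1r.
have [T [[a Ta] Tc Tagree HT]] := step k (leqnn k).
have TE b : T b = (b == a).
  by apply/idP/eqP => [Tb|->//]; apply: einj => i ik; exact: Tagree.
move: HT; rewrite (eq_bigl _ _ TE) big_pred1_eq big_geq // mulr1 => pk.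
have [ip p1 _] := pp k (leqnn k); apply: p1.
by rewrite -(rmorph1 f) -(mulVf (Tc a Ta)) rmorphM; exact: idMl.
Qed.

Lemma exists_left_kernel (K : fieldType) a b (M : 'M[K]_(a, b)) : (b < a)%N ->
  exists2 w : 'rV[K]_a, w != 0 & w *m M = 0.
Proof.
move=> ba; exists (nz_row (kermx M)).
  rewrite nz_row_eq0 -mxrank_eq0 mxrank_ker -lt0n subn_gt0.
  exact: leq_ltn_trans (rank_leq_col M) ba.
by apply/sub_kermxP; exact: nz_row_sub.
Qed.

Section ChainBound.
Variables (K : fieldType) (n : nat) (S : affine_semigroup n).
Local Notation A := (semigroup_algebra K S).
Variable M : prime_idealr A.
Local Notation R := (localization M).
Implicit Types (m : 'X_{1..n}) (p q : A).

Definition degree_le (p : A) d := forall m, m \in msupp (val p) -> (mdeg m <= d)%N.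

Lemma degree_le_exists p : exists d, degree_le p d.
Proof. by exists (msize (val p)) => m /msize_mdeg_lt/ltnW. Qed.

Lemma degree_leM p q d d' : degree_le p d -> degree_le q d' ->
  degree_le (p * q) (d + d').
Proof.
move=> pd qd m; rewrite rmorphM => /msuppM_le /allpairsP[[u v] /= [up vq ->]].
by rewrite mdegD leq_add // ?pd ?qd.
Qed.

Lemma degree_leX p d k : degree_le p d -> degree_le (p ^+ k) (k * d).
Proof.
move=> pd; elim: k => [|k IH]; last by rewrite exprS mulSn; exact: degree_leM.
by move=> m; rewrite expr0 rmorph1 msupp1 inE => /eqP ->; rewrite mdeg0.
Qed.

Lemma degree_le_trans p d d' : degree_le p d -> (d <= d')%N -> degree_le p d'.
Proof. by move=> pd dd m /pd h; exact: leq_trans dd. Qed.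

Lemma degree_le_prod (a : nat -> A) (e : nat -> nat) k N d :
  (forall i, (i < k)%N -> degree_le (a i) d) ->
  (forall i, (i < k)%N -> (e i <= N)%N) ->
  degree_le (\prod_(0 <= i < k) a i ^+ e i) (k * (N * d)).
Proof.
elim: k => [_ _|k IH ad eN].
  by move=> m; rewrite big_geq // rmorph1 msupp1 inE => /eqP ->; rewrite mdeg0.
rewrite big_nat_recr //= mulSn addnC; apply: degree_leM.
  by apply: IH => i ik; [apply: ad|apply: eN]; exact: ltnW.
apply: (@degree_le_trans _ (e k * d)); first by apply: degree_leX; exact: ad.
by rewrite leq_mul2r eN ?orbT.
Qed.

(* Modulo p_0 the elements of degree at most D of A are spanned by O(D^|T|)
   monomials, whereas the N^k monomials in k independent elements of bounded
   degree with exponents below N have degree O(N). *)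
Lemma chain_bound k (p : nat -> set R) (T : finType) (e : T -> 'X_{1..n})
    (F : seq 'X_{1..n}) :
  chain k p -> (forall t, e t != 0%MM) ->
  (forall m, asg_set S m -> p 0%N (loc_of M (monomial K S m)) \/
     exists f (b : T -> nat), f \in F /\ m = (f + \sum_t e t *+ b t)%MM) ->
  (k <= #|T|)%N.
Proof.
move=> cp e0 HF; rewrite leqNgt; apply/negP => Tk.
(* Length |T| + 1 is already too long. *)
have {Tk cp} cp := chain_trunc cp Tk; set l := #|T|.+1 in cp.
have Hx i : exists a : A, (i < l)%N -> p i.+1 (loc_of M a) /\ ~ p i (loc_of M a).
  have [il|il] := ltnP i l; last by exists 0.
  have [_ [x px npx]] := cp.2 i il.
  have [a [s [sM xE]]] := loc_of_surj x; exists a => _.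
  have [ip _ _] := cp.1 i.+1 il; have [ip' _ _] := cp.1 i (ltnW il).
  rewrite -xE; split; first exact: idMl.
  have [y yE] := loc_of_unit sM => /(idMl y ip').
  by rewrite mulrA [y * _]mulrC yE mul1r.
have {Hx} [a Ha] := choice Hx.
have [d ad] : exists d, forall i, (i < l)%N -> degree_le (a i) d.
  elim: (l) => [|j [d IH]]; first by exists 0%N.
  have [d' ad'] := degree_le_exists (a j); exists (maxn d d') => i.
  rewrite ltnS leq_eqVlt => /orP[/eqP ->|/IH h].
    exact: degree_le_trans ad' (leq_maxr _ _).
  exact: degree_le_trans h (leq_maxl _ _).
(* D bounds the degrees of all products [y u]. As D + 1 is at most (l d + 1) N and l = |T| + 1, this
   N gives |F| (D + 1)^|T| < N^l. *)
pose N := (size F * (l * d).+1 ^ #|T|).+1.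
pose D := (l * (N * d))%N.
pose E : finType := {ffun 'I_l -> 'I_N}.
pose ex (u : E) i := if insub i is Some j then u j : nat else 0%N.
have exE u (i : 'I_l) : ex u i = u i by rewrite /ex valK.
pose mk f (b : {ffun T -> 'I_D.+1}) := (f + \sum_t e t *+ b t)%MM.
pose G := undup [seq mk f b | f <- F, b <- enum {: {ffun T -> 'I_D.+1}}].
have szG : (size G < #|E|)%N.
  apply: leq_ltn_trans (size_undup _) _.
  rewrite size_allpairs -cardE card_ffun card_ord card_ffun !card_ord.
  apply: (@leq_ltn_trans (size F * ((l * d).+1 ^ #|T| * N ^ #|T|))).
    rewrite leq_mul2l -expnMn; apply/orP; right.
    have DN : (D.+1 <= (l * d).+1 * N)%N.
      by rewrite /D mulSn addnC mulnCA [(N * _)%N]mulnC -addn1 leq_add2l.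
    by elim: #|T| => // t IH; rewrite !expnS leq_mul.
  by rewrite mulnA expnS ltn_mul2r expn_gt0 /= ltnS.
pose y (u : E) : A := \prod_(0 <= i < l) a i ^+ ex u i.
have yD u : degree_le (y u) D.
  apply: degree_le_prod => // i il; rewrite (exE u (Ordinal il)).
  exact/ltnW/ltn_ord.
(* There are more products than monomials in [G], so some nontrivial combination q of the products
   has no monomial in [G]. *)
have [w w0 wM] := exists_left_kernel
  (\matrix_(u < #|E|, j < size G) (val (y (enum_val u)))@_(nth 0%MM G j)) szG.
pose c (u : E) : K := w 0 (enum_rank u).
pose q : A := \sum_u sga_const S (c u) * y u.
have qD : degree_le q D.
  move=> m; rewrite raddf_sum => /msupp_sum_le /flattenP[/= s].
  by move=> /mapP[u _ ->]; rewrite mul_mpolyC => /msuppZ_le; exact: yD.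
have qG m : m \in G -> (val q)@_m = 0.
  move=> mG; have im : (index m G < size G)%N by rewrite index_mem.
  move: wM => /matrixP/(_ 0 (Ordinal im)); rewrite !mxE => wm.
  rewrite -[RHS]wm raddf_sum /= raddf_sum /=.
  rewrite (reindex (@enum_val _ E)) /=; last exact: (onW_bij _ (@enum_val_bij _)).
  apply: eq_bigr => u _; rewrite mxE /= nth_index //.
  by rewrite mul_mpolyC mcoeffZ /c enum_valK.
(* A monomial of q outside p_0 would lie in [G]: its degree is at most D and every [e t] has
   positive degree, so all [b t] are at most D. *)
have pq : p 0%N (loc_of M q).
  have [ip _ _] := cp.1 0%N isT.
  rewrite (sga_expand q) rmorph_sum big_seq; apply: id_sum => // m mq.
  rewrite rmorphM; apply: idMl => //.
  have [//|[f [b [fF mE]]]] := HF m (msupp_asg mq).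
  have mG : m \in G.
    rewrite mem_undup; apply/allpairsP.
    exists (f, [ffun t => inord (b t)]); split=> //=; first by rewrite mem_enum.
    rewrite mE; congr (_ + _)%MM; apply: eq_bigr => t _; rewrite ffunE inordK //.
    rewrite ltnS; apply: leq_trans (qD m mq); rewrite mE mdegD.
    apply: leq_trans (leq_addl _ _); rewrite mdeg_sum (bigD1 t) //= mdegMn.
    apply: leq_trans (leq_addr _ _).
    by rewrite leq_pmull // lt0n mdeg_eq0.
  by move: mq; rewrite mcoeff_msupp qG ?eqxx.
have := @chain_independent K R (loc_of M \o @sga_const K n S) l p (loc_of M \o a) E ex c cp Ha.
case=> //.
- move=> u v uv; apply/ffunP => i; apply/val_inj.
  by have := uv i (ltn_ord i); rewrite !exE.
- have /rV0Pn[i wi] := w0; exists (enum_val i).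
  by rewrite /c enum_valK.
- move: pq; rewrite rmorph_sum; congr (p 0%N _); apply: eq_bigr => u _ /=.
  by rewrite rmorphM rmorph_prod; congr (_ * _); apply: eq_bigr => i _; rewrite rmorphXn.
Qed.

End ChainBound.

(** * Necessity of the exchange property *)

Section MultinomMuln.
Variable n : nat.
Implicit Types u v w : 'X_{1..n}.
Lemma addmAC u v w : (u + v + w = u + w + v)%MM.
Proof. by rewrite -!addmA [(v + w)%MM]addmC. Qed.
Lemma mulmnM u a b : (u *+ (a * b) = u *+ a *+ b)%MM.
Proof. by apply/mnmP => i; rewrite !mulmnE mulnA. Qed.
Lemma mulmnDr u a b : (u *+ (a + b) = u *+ a + u *+ b)%MM.
Proof. by apply/mnmP => i; rewrite mnmDE !mulmnE mulnDr. Qed.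
Lemma mulmDn u v a : ((u + v) *+ a = u *+ a + v *+ a)%MM.
Proof. by apply/mnmP => i; rewrite mnmDE !mulmnE mnmDE mulnDl. Qed.
Lemma mulm_sumn (I : Type) (s : seq I) (P : pred I) (F : I -> 'X_{1..n}) a :
  ((\sum_(i <- s | P i) F i) *+ a = \sum_(i <- s | P i) F i *+ a)%MM.
Proof.
by apply: (big_morph (fun u => u *+ a)%MM (fun u v => mulmDn u v a)); apply/mnmP => i; rewrite mulmnE mnm0E.
Qed.
Lemma mulmn_inj a : (0 < a)%N -> injective (fun u => u *+ a)%MM.
Proof.
move=> a0 u v /mnmP uv; apply/mnmP => i; have := uv i.
by rewrite !mulmnE => /eqP; rewrite eqn_pmul2r // => /eqP.
Qed.
End MultinomMuln.

(** * Semigroups over independent rays: finiteness and faces *)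

Section Simplicial.
Variables (n : nat) (S : affine_semigroup n) (r : nat) (e : 'I_r -> 'X_{1..n}).
Implicit Types (u v w m : 'X_{1..n}) (b c : 'I_r -> nat).

Definition comb b : 'X_{1..n} := (\sum_l e l *+ b l)%MM.

(** Independence and integrality are expressed with natural coefficients, signs and denominators
    being cleared. *)
Definition simplicial_rays :=
  [/\ forall l, asg_set S (e l),
      forall b c, comb b = comb c -> b =1 c &
      forall m, asg_set S m -> exists q b, (0 < q)%N /\ (m *+ q)%MM = comb b].

(* For the group G of S and g in G, this says that g + e_j in S and
   g + e_l in S imply g in S. *)
Definition exchange_property := forall j l u v, j != l -> asg_set S u ->
  asg_set S v -> (u + e l = v + e j)%MM -> exists2 w, asg_set S w & u = (w + e j)%MM.

Lemma combD b c : comb (fun l => b l + c l)%N = (comb b + comb c)%MM.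
Proof. by rewrite /comb -big_split; apply: eq_bigr => l _; rewrite mulmnDr. Qed.

Lemma combM b q : comb (fun l => b l * q)%N = (comb b *+ q)%MM.
Proof. by rewrite mulm_sumn; apply: eq_bigr => l _; rewrite mulmnM. Qed.

Lemma comb1 j : comb (fun l => (l == j) : nat) = e j.
Proof.
rewrite /comb (bigD1 j) //= eqxx mulm1n big1 ?addm0 // => l /negPf ->.
by rewrite mulm0n.
Qed.

Hypothesis eP : simplicial_rays.

Lemma comb_asg b : asg_set S (comb b).
Proof. by have [eS _ _] := eP; apply: asg_sum => l _; exact: asgMn. Qed.

Lemma ray_neq0 l : e l != 0%MM.
Proof.
apply/eqP => el0; have [_ efree _] := eP.
have := efree (fun i => i == l : nat) (fun=> 0%N) _ l; rewrite eqxx => H.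
by case/negP: (oner_neq0 nat); apply/eqP/H; rewrite comb1 el0 /comb big1 // => i _; rewrite mulm0n.
Qed.

(** Some positive multiple q_i of each generator is a combination of rays. Dividing its coefficient
    by q_i, the quotient goes into [comb b] and the remainder into f, which thus takes finitely many
    values. *)
Lemma finite_over_rays : exists F : seq 'X_{1..n}, forall m, asg_set S m ->
  exists f b, [/\ f \in F, asg_set S f & m = (f + comb b)%MM].
Proof.
have [eS efree edom] := eP; have [s sE] := asg_fin_gen S.
have H i : exists qb : nat * ('I_r -> nat), (i < size s)%N ->
    (0 < qb.1)%N /\ (nth 0%MM s i *+ qb.1)%MM = comb qb.2.
  have [si|si] := ltnP i (size s); last by exists (0%N, fun=> 0%N).
  have /edom[q [b H]] : asg_set S (nth 0%MM s i).
    by rewrite sE; apply: span_mem => /=; exact: mem_nth.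
  by exists (q, b).
have [qb Hqb] := choice H; pose q i := (qb i).1; pose b i := (qb i).2.
pose Q := (\sum_(i < size s) q i)%N.
exists [seq (\sum_(i < size s) nth 0%MM s i *+ (d i : nat))%MM |
  d : {ffun 'I_(size s) -> 'I_Q.+1}] => m.
rewrite {1}sE => /span_seqP[c ->].
exists (\sum_(i < size s) nth 0%MM s i *+ (c i %% q i))%MM.
exists (fun l => \sum_(i < size s) (b i l * (c i %/ q i)))%N; split.
  apply/mapP; exists [ffun i : 'I_(size s) => inord (c i %% q i)].
    by rewrite mem_enum.
  apply: eq_bigr => i _; rewrite ffunE inordK // ltnS.
  have [q0 _] := Hqb i (ltn_ord i).
  by rewrite (leq_trans (ltnW (ltn_pmod _ q0))) // /Q (bigD1 i) //= leq_addr.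
  apply: asg_sum => i _; apply: asgMn; rewrite sE; apply: span_mem => /=.
  exact: mem_nth.
rewrite -[X in (_ + X)%MM](_ : (\sum_(i < size s) comb (fun l => b i l * (c i %/ q i))%N)%MM = _).
  rewrite -big_split; apply: eq_bigr => i _ /=.
  rewrite combM; have [_ <-] := Hqb i (ltn_ord i).
  by rewrite -mulmnM -mulmnDr addnC mulnC -divn_eq.
rewrite /comb exchange_big; apply: eq_bigr => l _ /=.
by apply/mnmP => k; rewrite mnm_sumE mulmnE big_distrr; apply: eq_bigr => i _; rewrite mulmnE.
Qed.

(* The face spanned by the e_l with l >= j. *)
Definition face j m := exists q b, [/\ (0 < q)%N, forall l : 'I_r, (l < j)%N -> b l = 0%N &
  (m *+ q)%MM = comb b].

Lemma face_le j m : face j.+1 m -> face j m.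
Proof. by move=> [q [b [q0 b0 E]]]; exists q, b; split=> // l lj; apply: b0; exact: ltnW. Qed.

Lemma faceD_ray (j : 'I_r) m : face j m -> face j (e j + m)%MM.
Proof.
move=> [q [b [q0 b0 E]]]; exists q, (fun l => (l == j) * q + b l)%N; split=> //.
  move=> l lj; rewrite b0 // addn0.
  by case: eqP lj => [->|]; rewrite ?ltnn.
by rewrite mulmDn E combD combM comb1.
Qed.

Lemma face_ray (j : 'I_r) : ~ face j.+1 (e j).
Proof.
move=> [q [b [q0 b0 E]]]; have [_ efree _] := eP.
have := efree (fun l => (l == j) * q)%N b; rewrite combM comb1 => /(_ E j).
by rewrite eqxx mul1n b0 // => q0'; rewrite q0' in q0.
Qed.

(** Up to a common factor the ray coordinates of u + v are the sums of those of u and v, which are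
    nonnegative; where a sum vanishes, so do both summands. *)
Lemma face_addr j u v : asg_set S u -> asg_set S v -> face j (u + v)%MM -> face j v.
Proof.
have [_ efree edom] := eP.
move=> /edom[q1 [b1 [q10 E1]]] /edom[q2 [b2 [q20 E2]]] [q [b [q0 b0 E]]].
exists q2, b2; split=> // l lj.
have := efree (fun l => b l * (q1 * q2))%N (fun l => b1 l * (q2 * q) + b2 l * (q1 * q))%N.
rewrite combD !combM -E -E1 -E2 -!mulmnM => /(_ _ l); rewrite b0 //.
move=> /(_ _)/esym/eqP; rewrite mul0n addn_eq0 muln_eq0 => H.
suff /H/andP[_] : ((u + v) *+ (q * (q1 * q2)) =
    u *+ (q1 * (q2 * q)) + v *+ (q2 * (q1 * q)))%MM.
  by rewrite !muln_eq0 (gtn_eqF q10) (gtn_eqF q0) !orbF => /eqP.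
by rewrite mulmDn; congr (_ *+ _ + _ *+ _)%MM; lia.
Qed.

End Simplicial.

Section CohenMacaulayExchange.
Variables (K : fieldType) (n : nat) (S : affine_semigroup n) (r : nat) (e : 'I_r -> 'X_{1..n}).
Local Notation A := (semigroup_algebra K S).
Local Notation mon := (monomial K S).
Hypothesis eP : simplicial_rays S e.
Implicit Types (u v w m : 'X_{1..n}) (p q : A).

Definition no_constant_term : set A := [set p | (val p)@_0%MM = 0].

Lemma no_constant_term_prime : is_prime no_constant_term.
Proof.
have CM p q : (val (p * q))@_0%MM = (val p)@_0%MM * (val q)@_0%MM.
  by have [H _] := @mcoeff0_is_multiplicative n K; exact: H.
rewrite /no_constant_term; split=> /=.
- split=> [|p q p0 q0|p q q0]; first exact: mcoeff0.
    exact: (etrans (mcoeffD _ (val p) (val q)) (etrans (f_equal2 +%R p0 q0) (addr0 0))).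
  exact: (etrans (CM p q) (etrans (f_equal2 *%R erefl q0) (mulr0 _))).
- by move=> H; have := @mcoeff1 n K 0%MM; rewrite [LHS]H eqxx => /esym/eqP; rewrite oner_eq0.
- by move=> p q /=; rewrite [LHS]CM => /eqP; rewrite mulf_eq0 => /orP[] /eqP; [left|right].
Qed.

Lemma no_constant_term_maximal (M : prime_idealr A) :
  (forall p, p \in M <-> no_constant_term p) -> maximal_ideal M.
Proof.
move=> HM J MJ p pJ; apply/HM; apply: contrapT => p0.
have c0 : (val p)@_0%MM != 0 by apply/eqP.
suff : 1 \in J by rewrite idealr1.
have /MJ pJ' : p - sga_const S (val p)@_0%MM \in M.
  apply/HM; apply: (etrans (mcoeffB _ (val p) _)).
  by rewrite /= mcoeffC eqxx mulr1 subrr.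
have cJ : sga_const S (val p)@_0%MM \in J by have := rpredB pJ pJ'; rewrite subKr.
by rewrite -(rmorph1 (@sga_const K n S)) -(mulVf c0) rmorphM idealMr.
Qed.

(** The quotient by this ideal is the algebra of the face. The faces shrink as j grows, and
    [chain_below] turns the growing ideals into a chain of primes. *)
Definition face_ideal j : set A := [set p | forall m, m \in msupp (val p) -> ~ face e j m].

Lemma face_ideal_ideal j : is_ideal (face_ideal j).
Proof.
split=> [|p q Ip Iq|p q Iq] m.
- by rewrite rmorph0 msupp0 in_nil.
- by rewrite raddfD => /msuppD_le; rewrite mem_cat => /orP[/Ip|/Iq].
- rewrite rmorphM => /msuppM_le /allpairsP[[u v] /= [up vq ->]].
  move/(face_addr eP (msupp_asg up) (msupp_asg vq)); exact: Iq.
Qed.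

Lemma face_ideal_le j : face_ideal j `<=` face_ideal j.+1.
Proof. by move=> p Ip m /Ip H /face_le. Qed.

Lemma face_ideal_ray (j : 'I_r) : face_ideal j.+1 (mon (e j)).
Proof.
have [eS _ _] := eP; move=> m; rewrite val_monomial // => /mem_msuppXP <-.
exact: (face_ray eP).
Qed.

Lemma face_ideal_regular (j : 'I_r) : regular_mod (face_ideal j) (mon (e j)).
Proof.
have [eS _ _] := eP; move=> p Ip m mp fm; apply: (Ip (e j + m)%MM).
  by rewrite mcoeff_msupp monomialM_coef // -mcoeff_msupp.
exact: (faceD_ray fm).
Qed.

Lemma face_ideal_last : face_ideal r `<=` no_constant_term.
Proof.
move=> p Ip; apply: memN_msupp_eq0; apply/negP => /Ip; apply.
exists 1%N, (fun=> 0%N); split=> //.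
by rewrite mulm1n /comb big1 // => i _; rewrite mulm0n.
Qed.

Section Local.
Variables (M : prime_idealr A) (HM : forall p, p \in M <-> no_constant_term p).
Local Notation R := (localization M).

Lemma ray_prime_chain : prime_chain R r.
Proof.
have [pM M1 _] := @loc_max_prime A M.
pose x j : R := if insub j is Some l then loc_of M (mon (e l)) else 0.
have nR : noetherian R := loc_noetherian (@sga_noetherian K n S).
have [||||p cp _] := @chain_below R (fun j => @loc_ideal A M (face_ideal j)) x r (@loc_max A M) nR.
- by move=> j; apply: loc_ideal_ideal; exact: face_ideal_ideal.
- move=> j jr; have [l {j jr}->] : exists l : 'I_r, j = l by exists (Ordinal jr).
  rewrite /x valK; split.
  + move=> y [a [s [Ia sM yE]]]; exists a, s; split=> //; exact: face_ideal_le.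
  + by apply: loc_ideal_of; exact: face_ideal_ray.
  + by apply: loc_regular; [exact: face_ideal_ideal|exact: face_ideal_regular].
- exact: loc_max_prime.
- move=> y [a [s [Ia sM yE]]]; exists a, s; split=> //.
  by apply/HM; exact: face_ideal_last.
by apply/prime_chainP; exists p.
Qed.

(** A monomial outside p_0 involves neither e_j nor e_l in its expression over the rays, so
    [chain_bound] applies with the other r - 2 rays. *)
Lemma chain_above_two_rays k (p : nat -> set R) (j l : 'I_r) : chain k p -> j != l ->
  p 0%N (loc_of M (mon (e j))) -> p 0%N (loc_of M (mon (e l))) -> (k.+2 <= r)%N.
Proof.
move=> cp jl pj pl; have [F FE] := finite_over_rays eP; have [eS _ _] := eP.
have [ip _ _] := cp.1 0%N isT.
pose T : finType := {i : 'I_r | i \in [pred i | (i != j) && (i != l)]}.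
have -> : r = #|T|.+2.
  rewrite card_sig -[LHS]card_ord -(cardC [pred i | (i == j) || (i == l)]).
  rewrite (_ : #|[pred i | (i == j) || (i == l)]| = 2%N).
    by rewrite add2n; congr _.+2; apply: eq_card => i; rewrite !inE negb_or.
  by have := card2 j l; rewrite jl => <-; exact: eq_card.
rewrite !ltnS; apply: (@chain_bound K n S M k p T (fun t => e (val t)) F cp).
  by move=> t; exact: (ray_neq0 eP).
move=> m Sm; have [f [b [fF Sf mE]]] := FE m Sm.
have H i : p 0%N (loc_of M (mon (e i))) -> (0 < b i)%N -> p 0%N (loc_of M (mon m)).
  move=> pi bi.
  have Sb := comb_asg eP (fun l => b l - (l == i))%N.
  have -> : m = (e i + (f + comb e (fun l => b l - (l == i))%N))%MM.
    rewrite addmA [(e i + f)%MM]addmC -addmA -{1}(comb1 e i) -combD mE; congr (_ + _)%MM.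
    by apply: eq_bigr => t _; case: eqP => [->|_]; rewrite ?subnKC ?subn0.
  by rewrite monomialD //; [rewrite rmorphM; exact: idMr|exact: asgD].
have [/H h|] := ltnP 0 (b j); first by left; exact: h.
have [/H h _|] := ltnP 0 (b l); first by left; exact: h.
rewrite !leqn0 => /eqP bl /eqP bj; right; exists f, (fun t => b (val t)); split=> //.
rewrite mE; congr (_ + _)%MM; rewrite /comb -(@big_sub _ _ _ _ _ (fun i => e i *+ b i)%MM).
rewrite [RHS]big_mkcond; apply: eq_bigr => i _; rewrite inE.
case: eqP => [->|_] /=; first by rewrite bj mulm0n.
by case: eqP => [->|_] /=; first by rewrite bl mulm0n.
Qed.

Lemma loc_zero_ideal (x : R) : loc_ideal [set 0] x -> x = 0.
Proof.
move=> Ix; have : @loc_ideal A M (ideal_gen [::]) x by rewrite ideal_gen_nil.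
by rewrite loc_ideal_gen ideal_gen_nil.
Qed.

Lemma exchange_of_local : cohen_macaulay_local R -> exchange_property S e.
Proof.
move=> cmR j l u v jl Su Sv E; have [eS _ _] := eP.
apply: contrapT => nw.
have nR : noetherian R := loc_noetherian (@sga_noetherian K n S).
have [ys [rys rsize]] := cohen_macaulay_local_elim cmR ray_prime_chain.
pose x : R := loc_of M (mon (e j)); pose y : R := loc_of M (mon (e l)).
pose z : R := loc_of M (mon u).
have i0 : is_ideal [set (0 : R)] by exact: zero_ideal.
have rx : regular_mod [set 0] x.
  move=> c xc; apply: loc_zero_ideal.
  have : regular_mod [set (0 : A)] (mon (e j)).
    move=> a /= /eqP; rewrite mulf_eq0 => /orP[] /eqP // H.
    have := val_monomial K (eS j); rewrite H rmorph0 => /(congr1 (mcoeff (e j))).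
    by rewrite mcoeff0 mcoeffX eqxx => /esym/eqP; rewrite oner_eq0.
  move/(loc_regular (@zero_ideal A)); apply.
  by rewrite -/x [x * c]xc; apply: id0; apply: loc_ideal_ideal; exact: zero_ideal.
(* A denominator s has nonzero constant term, so u stays in the support of s times its monomial.
   Divisibility by x_j then gives u = e_j + k with k in S, which was excluded. *)
have nz : ~ add_ideal [set 0] x z.
  move=> [_ [c [/= -> zE]]]; have [b [s [sM cE]]] := loc_of_surj c.
  have {}zE : mon u * s = mon (e j) * b.
    apply: (@loc_of_inj A M); rewrite !rmorphM /= -cE -/z -/x zE add0r.
    by rewrite mulrC mulrA [x * _]mulrC.
  have us : u \in msupp (val (mon (e j) * b)).
    rewrite mcoeff_msupp -zE -{1}(addm0 u) monomialM_coef //.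
    by apply: contra sM => /eqP; exact: (HM _).2.
  have [k uE kb] := msupp_monomialM (eS j) us.
  by apply: nw; exists k; [exact: msupp_asg kb|rewrite addmC].
(* y z is x times the monomial of v, since u + e_l = v + e_j. *)
have Jz : [set w | w = x \/ w = y] `<=` colon (add_ideal [set 0] x) z.
  move=> w [->|->]; rewrite /colon /=.
    by exists 0, z; split=> //; rewrite add0r mulrC.
  exists 0, (loc_of M (mon v)); split=> //; rewrite add0r -!rmorphM -!monomialD //.
  by rewrite addmC E.
have [P [t [pP JP It Pt]]] := associated_prime nR (add_ideal_ideal x i0) nz Jz.
have [p cp p0] := chain_above_mod_regular nR (@loc_max_prime A M) (@loc_max_local A M)
  i0 rys rx pP (JP x (or_introl erefl)) (ex_intro2 _ _ t It Pt).
have := chain_above_two_rays cp jl.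
rewrite p0 => /(_ (JP x (or_introl erefl)) (JP y (or_intror erefl))).
(* For nonempty [ys] the bound reads size ys + 1 <= r, against r <= size ys; for empty [ys] the
   predecessor is 0 and it reads 2 <= r, against r <= 0. *)
case: (size ys) rsize => [|k] /= h1 h2; last by have := leq_trans h2 h1; rewrite ltnn.
by have := leq_trans h2 h1.
Qed.

End Local.

Lemma exchange_of_cohen_macaulay : cohen_macaulay A -> exchange_property S e.
Proof.
move=> [_ cmA]; have [M HM] := is_prime_prime_idealr no_constant_term_prime.
by apply: (exchange_of_local HM); apply: cmA; exact: no_constant_term_maximal.
Qed.

End CohenMacaulayExchange.

(** * Sufficiency of the exchange property *)

(* The operators rho_i are remainders modulo F_i, and their composites have
   the ideals (F_0, ..., F_{i-1}) as kernels. *)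
Lemma regular_of_remainders (A : idomainType) (N : nat) (F : nat -> A) (rho : nat -> A -> A) :
  (forall i a b, rho i (a + b) = rho i a + rho i b) ->
  (forall i a, (i < N)%N -> rho i (F i * a) = 0) ->
  (forall i a, (i < N)%N -> exists b, a = rho i a + b * F i) ->
  (forall i j a, (i < N)%N -> (j < N)%N -> i != j -> rho i (F j * a) = F j * rho i a) ->
  (forall i, (i < N)%N -> F i != 0) ->
  forall i, (i < N)%N -> regular_mod (ideal_gen (mkseq F i)) (F i).
Proof.
move=> rhoD rho0 rhoE rhoC F0.
have rho00 i : rho i 0 = 0 by apply: (addrI (rho i 0)); rewrite -rhoD !addr0.
pose Rk := fix Rk k a := if k is j.+1 then rho j (Rk j a) else a : A.
have RkD k a b : Rk k (a + b) = Rk k a + Rk k b by elim: k => //= k ->.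
have Rk0 k : Rk k 0 = 0 by elim: k => //= k ->.
have RkC k j a : (k <= j)%N -> (j < N)%N -> Rk k (F j * a) = F j * Rk k a.
  elim: k => //= k IH kj jN; rewrite IH ?(ltnW kj) // rhoC //.
    exact: ltn_trans kj jN.
  by rewrite (ltn_eqF kj).
have RkF k j a : (j < k <= N)%N -> Rk k (F j * a) = 0.
  elim: k => // k IH /andP[]; rewrite ltnS leq_eqVlt => /orP[/eqP ->|jk] kN /=.
    by rewrite RkC // rho0.
  by rewrite IH ?rho00 // jk ltnW.
have sub k a : (k <= N)%N -> ideal_gen (mkseq F k) (a - Rk k a).
  elim: k => [|k IH] kN.
    by rewrite subrr; apply: id0; exact: ideal_gen_ideal.
  rewrite mkseqS ideal_gen_rcons /=.
  have [b bE] := rhoE k (Rk k a) kN.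
  exists (a - Rk k a), b; split; first exact/IH/ltnW.
  have -> : rho k (Rk k a) = Rk k a - b * F k by rewrite {2}bE addrK.
  by rewrite opprB addrA addrAC.
have ker k a : (k <= N)%N -> ideal_gen (mkseq F k) a -> Rk k a = 0.
  move=> kN [c ->]; elim/big_ind: _ => //; first by move=> x y; rewrite RkD => -> ->; rewrite addr0.
  move=> i _; have := ltn_ord i; rewrite {2}size_mkseq => ik.
  by rewrite nth_mkseq // mulrC RkF // ik.
(* F_i times the composite remainder of c is zero; in a domain that remainder vanishes, so c is in
   the ideal. *)
move=> i iN c /(ker _ _ (ltnW iN)); rewrite RkC // => /eqP.
rewrite mulf_eq0 (negPf (F0 i iN)) => /eqP Rc.
by have := sub i c (ltnW iN); rewrite Rc subr0.
Qed.

Section LinearExtension.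
Variables (K : fieldType) (n : nat) (S : affine_semigroup n).
Local Notation A := (semigroup_algebra K S).
Implicit Types (tau : 'X_{1..n} -> A).

Definition extend tau (p : A) : A :=
  \sum_(m <- msupp (val p)) sga_const S (val p)@_m * tau m.

Lemma extend_wide tau p (s : seq 'X_{1..n}) : uniq s -> {subset msupp (val p) <= s} ->
  extend tau p = \sum_(m <- s) sga_const S (val p)@_m * tau m.
Proof.
move=> us sub; rewrite [RHS](bigID (fun m => m \in msupp (val p))) /= [X in _ + X]big1 ?addr0.
  rewrite -big_filter; apply: perm_big; apply: uniq_perm; rewrite ?msupp_uniq ?filter_uniq //.
  by move=> m; rewrite mem_filter andb_idr //; exact: sub.
by move=> m /memN_msupp_eq0 H; rewrite [mcoeff _ _]H rmorph0 mul0r.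
Qed.

Lemma extendD tau p q : extend tau (p + q) = extend tau p + extend tau q.
Proof.
pose s := undup (msupp (val p) ++ msupp (val q)).
have us : uniq s by exact: undup_uniq.
rewrite !(@extend_wide _ _ s) //.
- rewrite -big_split; apply: eq_bigr => m _ /=.
  by rewrite -mulrDl -rmorphD -mcoeffD.
- by move=> m mq; rewrite mem_undup mem_cat mq orbT.
- by move=> m mp; rewrite mem_undup mem_cat mp.
- by move=> m; rewrite raddfD => /msuppD_le; rewrite mem_undup.
Qed.

Lemma extend_sum tau (I : Type) (r : seq I) (P : pred I) (F : I -> A) :
  extend tau (\sum_(i <- r | P i) F i) = \sum_(i <- r | P i) extend tau (F i).
Proof.
apply: (big_morph (extend tau) (extendD tau)).
by rewrite /extend rmorph0 msupp0 big_nil.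
Qed.

Lemma extend_monomial tau c m : asg_set S m ->
  extend tau (sga_const S c * monomial K S m) = sga_const S c * tau m.
Proof.
move=> Sm; have E : val (sga_const S c * monomial K S m) = c *: 'X_[m].
  by rewrite val_sga_constM val_monomial.
rewrite (@extend_wide _ _ [:: m]) //.
  by rewrite big_seq1 E mcoeffZ mcoeffX eqxx mulr1.
by move=> k; rewrite E => /msuppZ_le; rewrite msuppX.
Qed.

End LinearExtension.

(** * Division with remainder along a ray *)

Section Remainders.
Variables (K : fieldType) (n : nat) (S : affine_semigroup n) (r : nat) (e : 'I_r -> 'X_{1..n}).
Local Notation A := (semigroup_algebra K S).
Local Notation mon := (monomial K S).
Hypotheses (eP : simplicial_rays S e) (eX : exchange_property S e).
Implicit Types (u v w m : 'X_{1..n}) (p q : A) (g : {poly K}) (l j : 'I_r).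

(** The monomials of these elements form a basis of A over the polynomial ring in x_l. *)
Definition irreducible_at l w := asg_set S w /\ ~ exists2 v, asg_set S v & w = (v + e l)%MM.

Lemma ray_decomposition l m : asg_set S m ->
  exists wk : 'X_{1..n} * nat, irreducible_at l wk.1 /\ m = (wk.1 + e l *+ wk.2)%MM.
Proof.
move: {2}(mdeg m) (leqnn (mdeg m)) => d; elim: d m => [|d IH] m md Sm.
all: have [[v Sv mE]|nv] := pselect (exists2 v, asg_set S v & m = (v + e l)%MM);
  last by exists (m, 0%N); rewrite mulm0n addm0.
  move: md; rewrite mE mdegD leqn0 addn_eq0 => /andP[_].
  by rewrite mdeg_eq0 (negPf (ray_neq0 eP l)).
have [||[w k] /= [wI vE]] := IH v => //.
  rewrite -ltnS; apply: leq_trans md; rewrite mE mdegD -addn1 leq_add2l lt0n mdeg_eq0.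
  exact: (ray_neq0 eP).
by exists (w, k.+1); rewrite mE vE -addmA mulmSr.
Qed.

Lemma ray_decomposition_unique l w w' k k' : irreducible_at l w -> irreducible_at l w' ->
  (w + e l *+ k = w' + e l *+ k')%MM -> w = w' /\ k = k'.
Proof.
have [eS _ _] := eP.
wlog kk' : w w' k k' / (k <= k')%N.
  move=> H iw iw' E; have [|/ltnW] := leqP k k' => h; first exact: H.
  by have [-> ->] := H w' w k' k h iw' iw (esym E).
move=> [Sw iw] [Sw' iw']; rewrite -(subnKC kk') mulmnDr addmA addmC [(w' + _)%MM]addmC -addmA.
move/addmI; case: (k' - k)%N => [|d] wE; first by rewrite mulm0n addm0 addn0 in wE *.
case: iw; exists (w' + e l *+ d)%MM; first by apply: asgD => //; exact: asgMn.
by rewrite wE -addmA mulmSr.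
Qed.

Definition ray_eval l g : A := (map_poly (@sga_const K n S) g).[mon (e l)].

Lemma ray_evalM l g h : ray_eval l (g * h) = ray_eval l g * ray_eval l h.
Proof. by rewrite /ray_eval rmorphM hornerM. Qed.
Lemma ray_evalD l g h : ray_eval l (g + h) = ray_eval l g + ray_eval l h.
Proof. by rewrite /ray_eval rmorphD hornerD. Qed.
Lemma ray_evalC l c : ray_eval l c%:P = sga_const S c.
Proof. by rewrite /ray_eval map_polyC hornerC. Qed.
Lemma ray_evalX l : ray_eval l 'X = mon (e l).
Proof. by rewrite /ray_eval map_polyX hornerX. Qed.

Lemma ray_evalXn l k : ray_eval l 'X^k = mon (e l *+ k).
Proof.
have [eS _ _] := eP; elim: k => [|k IH].
  by rewrite expr0 mulm0n monomial0 ray_evalC rmorph1.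
by rewrite exprS ray_evalM IH ray_evalX mulmS monomialD //; exact: asgMn.
Qed.

Lemma ray_eval_sum l g : ray_eval l g = \sum_(i < size g) sga_const S g`_i * mon (e l *+ i).
Proof.
rewrite -{1}(coefK g) poly_def /ray_eval rmorph_sum horner_sum.
apply: eq_bigr => i _; rewrite -mul_polyC.
by rewrite -/(ray_eval l _) ray_evalM ray_evalC ray_evalXn.
Qed.

Section Remainder.
Variables (l : 'I_r) (f : {poly K}).

(** In the basis of monomials irreducible at l, each coefficient, a polynomial in x_l, is reduced
    modulo f. The operator is prescribed on monomials through their unique decomposition and
    extended linearly. *)
Lemma remainder_exists : exists rho : A -> A,
  (forall p q, rho (p + q) = rho p + rho q) /\
  forall w g, irreducible_at l w ->
    rho (mon w * ray_eval l g) = mon w * ray_eval l (g %% f).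
Proof.
have [eS _ _] := eP.
have H m : exists wk : 'X_{1..n} * nat, asg_set S m ->
    irreducible_at l wk.1 /\ m = (wk.1 + e l *+ wk.2)%MM.
  have [/(ray_decomposition l)[wk H]|nS] := pselect (asg_set S m); first by exists wk.
  by exists (0%MM, 0%N).
have [d Hd] := choice H.
pose tau m := mon (d m).1 * ray_eval l ('X^((d m).2) %% f).
have tauE w k : irreducible_at l w -> tau (w + e l *+ k)%MM = mon w * ray_eval l ('X^k %% f).
  move=> iw; have Sm : asg_set S (w + e l *+ k)%MM.
    by apply: asgD; [case: iw|exact: asgMn].
  have [id dE] := Hd _ Sm.
  by have [E1 E2] := ray_decomposition_unique id iw (esym dE); rewrite /tau E1 E2.
exists (extend tau); split=> [p q|w g iw]; first exact: extendD.
have [Sw _] := iw.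
rewrite ray_eval_sum mulr_sumr extend_sum.
transitivity (\sum_(i < size g) mon w * ray_eval l ((g`_i *: 'X^i) %% f)).
  apply: eq_bigr => i _; rewrite mulrCA -monomialD //; last exact: asgMn.
  rewrite extend_monomial; last by apply: asgD => //; exact: asgMn.
  by rewrite tauE // modpZl -mul_polyC ray_evalM ray_evalC mulrCA.
rewrite -mulr_sumr; congr (_ * _); rewrite -[in RHS](coefK g) poly_def.
rewrite (big_morph (fun h => h %% f) (fun a b => modpD f a b) (mod0p f)).
by rewrite (big_morph (ray_eval l) (ray_evalD l) (ray_evalC l 0)) // rmorph0.
Qed.

Definition remainder : A -> A := sval (cid remainder_exists).

Lemma remainderD p q : remainder (p + q) = remainder p + remainder q.
Proof. by rewrite /remainder; case: cid => rho [/= H _]. Qed.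

Lemma remainderE w g : irreducible_at l w ->
  remainder (mon w * ray_eval l g) = mon w * ray_eval l (g %% f).
Proof. by rewrite /remainder; case: cid => rho [/= _ H]; exact: H. Qed.

Lemma ray_ind (P : A -> Prop) : P 0 -> (forall p q, P p -> P q -> P (p + q)) ->
  (forall w g, irreducible_at l w -> P (mon w * ray_eval l g)) -> forall p, P p.
Proof.
have [eS _ _] := eP; move=> P0 PD Pw p; rewrite (sga_expand p) big_seq.
elim/big_ind: _ => // m /msupp_asg Sm.
have [[w k] /= [iw ->]] := ray_decomposition l Sm; have [Sw _] := iw.
rewrite monomialD //; last exact: asgMn.
by rewrite -ray_evalXn mulrCA -(ray_evalC l) -ray_evalM; exact: Pw.
Qed.

Lemma remainder0 : remainder 0 = 0.
Proof. by apply: (addrI (remainder 0)); rewrite -remainderD !addr0. Qed.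

Lemma remainder_mull p : remainder (ray_eval l f * p) = 0.
Proof.
elim/ray_ind: p => [|p q Hp Hq|w g iw]; first by rewrite mulr0 remainder0.
  by rewrite mulrDr remainderD Hp Hq addr0.
by rewrite mulrCA -ray_evalM remainderE // modp_mulr ray_evalC rmorph0 mulr0.
Qed.

Lemma remainder_sub p : exists q, p = remainder p + q * ray_eval l f.
Proof.
elim/ray_ind: p => [|p q [p' Hp] [q' Hq]|w g iw].
- by exists 0; rewrite remainder0 mul0r addr0.
- by exists (p' + q'); rewrite remainderD {1}Hp {1}Hq mulrDl addrACA.
- exists (mon w * ray_eval l (g %/ f)).
  by rewrite remainderE // -mulrA -ray_evalM -mulrDr -ray_evalD addrC -divp_eq.
Qed.

Lemma remainderC c p : remainder (sga_const S c * p) = sga_const S c * remainder p.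
Proof.
elim/ray_ind: p => [|p q Hp Hq|w g iw]; first by rewrite mulr0 remainder0 mulr0.
  by rewrite mulrDr !remainderD mulrDr Hp Hq.
rewrite mulrCA -(ray_evalC l) -ray_evalM !remainderE // mul_polyC modpZl -mul_polyC.
by rewrite ray_evalM mulrCA.
Qed.

(** Here the exchange property enters: w + e_j = v + e_l would make w reducible at l. So
    multiplication by x_j maps basis monomials to basis monomials and leaves the coefficients in x_l
    alone. *)
Lemma remainder_ray j p : j != l -> remainder (mon (e j) * p) = mon (e j) * remainder p.
Proof.
have [eS _ _] := eP; move=> jl.
elim/ray_ind: p => [|p q Hp Hq|w g iw]; first by rewrite mulr0 remainder0 mulr0.
  by rewrite mulrDr !remainderD mulrDr Hp Hq.
have [Sw nw] := iw; rewrite remainderE // mulrA -monomialD // remainderE.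
  by rewrite monomialD // mulrA.
split; first exact: asgD.
move=> [v Sv E]; apply: nw.
apply: (eX (j := l) (l := j) _ Sw Sv) => //; first by rewrite eq_sym.
by rewrite addmC.
Qed.

Lemma remainder_ray_eval j h p : j != l ->
  remainder (ray_eval j h * p) = ray_eval j h * remainder p.
Proof.
move=> jl; elim/poly_ind: h p => [|h c IH] p.
  by rewrite ray_evalC rmorph0 !mul0r remainder0.
rewrite ray_evalD ray_evalM ray_evalC ray_evalX !mulrDl remainderD remainderC.
by rewrite -!mulrA IH remainder_ray.
Qed.

End Remainder.

Lemma ray_eval_neq0 l f : f != 0 -> ray_eval l f != 0.
Proof.
have [eS _ _] := eP; move=> f0; apply/eqP => E; case/eqP: f0; apply/polyP => k.
rewrite coef0; have [kf|kf] := ltnP k (size f); last by rewrite nth_default.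
have := congr1 (fun p : A => (val p)@_(e l *+ k)%MM) E.
rewrite ray_eval_sum rmorph0 mcoeff0 raddf_sum /= raddf_sum /=.
rewrite (bigD1 (Ordinal kf)) //= big1 ?addr0.
  rewrite mul_mpolyC mcoeffZ (val_monomial K) ?mcoeffX ?eqxx ?mulr1 //; exact: asgMn.
move=> i; rewrite -val_eqE /= => ik.
rewrite mul_mpolyC mcoeffZ (val_monomial K) ?mcoeffX; last exact: asgMn.
case: eqP => [H|_]; last by rewrite mulr0.
case/negP: ik; have := congr1 (@mdeg n) H; rewrite !mdegMn => /eqP.
by rewrite eqn_pmul2l // lt0n mdeg_eq0 (ray_neq0 eP).
Qed.

Lemma rays_regular (f : 'I_r -> {poly K}) (s := [seq ray_eval l (f l) | l <- enum 'I_r]) :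
  (forall l, f l != 0) ->
  forall i, (i < size s)%N -> regular_mod (ideal_gen (take i s)) s`_i.
Proof.
move=> f0; pose F i := if insub i is Some l then ray_eval l (f l) else 0.
pose rho i : A -> A := if insub i is Some l then remainder l (f l) else fun=> 0.
have FE (l : 'I_r) : F l = ray_eval l (f l) by rewrite /F valK.
have rhoE (l : 'I_r) : rho l = remainder l (f l) by rewrite /rho valK.
have -> : s = mkseq F r.
  rewrite /mkseq -val_enum_ord -map_comp; apply: eq_map => l /=.
  by rewrite FE.
rewrite size_mkseq => i ir.
have -> : take i (mkseq F r) = mkseq F i by rewrite /mkseq -map_take take_iota (minn_idPl (ltnW ir)).
rewrite nth_mkseq //.
have ordE (k : nat) : (k < r)%N -> exists l : 'I_r, k = l.
  by move=> kr; exists (Ordinal kr).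
apply: (@regular_of_remainders A r F rho) ir.
- by move=> j a b; rewrite /rho; case: insub => [l|]; [exact: remainderD|rewrite addr0].
- by move=> j a jr; have [l ->] := ordE j jr; rewrite FE rhoE remainder_mull.
- by move=> j a jr; have [l ->] := ordE j jr; rewrite FE rhoE; exact: remainder_sub.
- move=> j k a jr kr; have [l ->] := ordE j jr; have [l' ->] := ordE k kr => ll'.
  by rewrite FE rhoE; apply: remainder_ray_eval; rewrite eq_sym -val_eqE.
- by move=> k kr; have [l ->] := ordE k kr; rewrite FE ray_eval_neq0.
Qed.

End Remainders.

(** * The Nullstellensatz *)

Lemma digits_inj N k (a b : nat -> nat) :
  (forall i, (i < k)%N -> (a i < N)%N) -> (forall i, (i < k)%N -> (b i < N)%N) ->
  (\sum_(i < k) a i * N ^ i = \sum_(i < k) b i * N ^ i)%N ->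
  forall i, (i < k)%N -> a i = b i.
Proof.
have bound (c : nat -> nat) j : (forall i, (i < j)%N -> (c i < N)%N) ->
    (\sum_(i < j) c i * N ^ i < N ^ j)%N.
  elim: j => [|j IH] cN; first by rewrite big_ord0.
  rewrite big_ord_recr /= expnS.
  have h1 : (\sum_(i < j) c i * N ^ i < N ^ j)%N by apply: IH => i ij; apply: cN; exact: ltnW.
  apply: (@leq_trans ((c j).+1 * N ^ j)); first by rewrite mulSn ltn_add2r.
  by rewrite leq_mul2r cN ?orbT.
elim: k => // k IH aN bN; rewrite !big_ord_recr /= => E.
have sa : (\sum_(i < k) a i * N ^ i < N ^ k)%N by apply: bound => i ij; apply: aN; exact: ltnW.
have sb : (\sum_(i < k) b i * N ^ i < N ^ k)%N by apply: bound => i ij; apply: bN; exact: ltnW.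
have Nk : (0 < N ^ k)%N by exact: leq_ltn_trans sa.
have akbk : a k = b k.
  move: (congr1 (fun x => x %/ N ^ k)%N E); rewrite addnC [(_ + b k * _)%N]addnC.
  by rewrite !divnMDl // !divn_small // !addn0.
move: E; rewrite akbk => /addIn E i; rewrite ltnS leq_eqVlt => /orP[/eqP -> //|].
by apply: (IH _ _ E) => j jk; [apply: aN|apply: bN]; exact: ltnW.
Qed.

Section MonicSize.
Variable B : idomainType.
Definition monic_size (d : nat) (p : {poly B}) := p \is monic /\ size p = d.+1.

Lemma monic_sizeM d d' p q : monic_size d p -> monic_size d' q -> monic_size (d + d') (p * q).
Proof.
move=> [mp sp] [mq sq]; split; first by rewrite monicMl.
by rewrite size_monicM ?monic_neq0 // sp sq addnS.
Qed.

Lemma monic_sizeX d p k : monic_size d p -> monic_size (d * k) (p ^+ k).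
Proof.
move=> H; elim: k => [|k IH]; last by rewrite exprS mulnS; exact: monic_sizeM.
by rewrite muln0 expr0; split; [exact: monic1|rewrite size_poly1].
Qed.

Lemma monic_size_prod k (p : 'I_k -> {poly B}) (d : 'I_k -> nat) :
  (forall i, monic_size (d i) (p i)) -> monic_size (\sum_i d i) (\prod_i p i).
Proof.
move=> H; elim/big_ind2: _ => //; first by split; [exact: monic1|rewrite size_poly1].
by move=> d1 p1 d2 p2; exact: monic_sizeM.
Qed.
End MonicSize.

Section Nagata.
Variables (K : fieldType) (k : nat).
Local Notation B := {mpoly K[k]}.
Variable N : nat.
Hypothesis N_gt1 : (1 < N)%N.

(** The variable of index 0 becomes T, as N^0 = 1; the one of index i > 0 becomes T^(N^i) plus one
    of the k remaining variables. *)
Definition nagata_var (i : 'I_k.+1) : {poly B} :=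
  'X^(N ^ i) + (if unlift ord0 i is Some j then ('X_j)%:P else 0).

Definition nagata : {mpoly K[k.+1]} -> {poly B} :=
  mmap (polyC \o @mpolyC k K) nagata_var.

Definition weight (m : 'X_{1..k.+1}) := (\sum_(i < k.+1) N ^ i * m i)%N.

Lemma nagata_monomial m : monic_size (weight m) (mmap1 nagata_var m).
Proof.
apply: monic_size_prod => i; apply: monic_sizeX; rewrite /nagata_var.
set t : {poly B} := if unlift ord0 i is Some j then _ else _.
have lt : (size t < size ('X^(N ^ i) : {poly B}))%N.
  rewrite size_polyXn /t; case: unliftP => [j ->|_]; last by rewrite size_poly0.
  apply: leq_ltn_trans (size_polyC_leq1 _) _.
  by rewrite ltnS expn_gt0 ltnW.
split; last by rewrite size_polyDl // size_polyXn.
by rewrite monicE lead_coefDl // lead_coefXn.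
Qed.

(** With exponents below N the weights are base-N expansions, so distinct monomials have distinct
    weights. The heaviest one alone contributes to the leading coefficient, which is therefore
    constant. *)
Lemma nagata_monic (f : {mpoly K[k.+1]}) : f != 0 ->
  (forall m, m \in msupp f -> forall i, (m i < N)%N) ->
  exists2 c : K, c != 0 & c%:MP%:P * nagata f \is monic.
Proof.
move=> f0 fN.
have f1 : msupp f != [::] by rewrite msupp_eq0.
have [m0 m0f m0max] : exists2 m0, m0 \in msupp f &
    forall m, m \in msupp f -> m != m0 -> (weight m < weight m0)%N.
  have [m0 m0f H] : exists2 m0, m0 \in msupp f &
      forall m, m \in msupp f -> (weight m <= weight m0)%N.
    elim: (msupp f) f1 => // m [|m' s] IH _.
      by exists m; rewrite ?mem_head // => m'; rewrite inE => /eqP ->.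
    have [//|m0 m0s H] := IH.
    have [le|/ltnW le] := leqP (weight m) (weight m0).
      exists m0; first by rewrite inE m0s orbT.
      by move=> m1; rewrite inE => /orP[/eqP ->|/H].
    exists m; first exact: mem_head.
    by move=> m1; rewrite inE => /orP[/eqP ->//|/H h]; exact: leq_trans le.
  exists m0 => // m mf ne; rewrite ltn_neqAle H // andbT.
  apply: contra ne => /eqP E; apply/eqP/mnmP => i.
  pose a j := m (inord j); pose b j := m0 (inord j).
  rewrite -(inord_val i); apply: (@digits_inj N k.+1 a b) (ltn_ord i).
  - by move=> j _; exact: fN.
  - by move=> j _; exact: fN.
  - move: E; rewrite /weight => E.
    rewrite (eq_bigr (fun j : 'I_k.+1 => N ^ j * m j)%N).
      rewrite E; apply: eq_bigr => j _; by rewrite /b inord_val mulnC.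
    by move=> j _; rewrite /a inord_val mulnC.
exists (f@_m0)^-1; first by rewrite invr_eq0 -mcoeff_msupp.
have coef : (nagata f)`_(weight m0) = (f@_m0)%:MP.
  rewrite /nagata /mmap coef_sum (bigD1_seq m0) ?msupp_uniq //= coefCM.
  have [mon sz] := nagata_monomial m0.
  move: mon; rewrite monicE lead_coefE sz /= => /eqP ->; rewrite mulr1.
  rewrite big_seq_cond big1 ?addr0 // => m /andP[mf ne].
  have [_ sz'] := nagata_monomial m.
  by rewrite coefCM nth_default ?mulr0 // sz'; exact: m0max.
have c0 : f@_m0 != 0 by rewrite -mcoeff_msupp.
have sz : (size (nagata f) <= (weight m0).+1)%N.
  apply: (leq_trans (size_sum _ _ _)); apply/bigmax_leqP_seq => m mf _.
  rewrite size_Cmul ?mpolyC_eq0 -?mcoeff_msupp //.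
  have [_ ->] := nagata_monomial m; rewrite ltnS.
  by have [->//|ne] := eqVneq m m0; exact/ltnW/m0max.
have szE : size (nagata f) = (weight m0).+1.
  apply/eqP; rewrite eqn_leq sz /= ltnNge; apply/negP => H.
  by move: c0; rewrite -(mpolyC_eq0 k) -coef nth_default ?eqxx.
by rewrite monicE lead_coefM lead_coefC lead_coefE szE /= coef -mpolyCM mulVf.
Qed.

(** [z] undoes Nagata's substitution: with T at y_0 and the remaining variables at z, the
    substituted variables take the values y. *)
Lemma nagata_eval (L : comNzRingType) (phi : {rmorphism K -> L}) (y : 'I_k.+1 -> L)
    (f : {mpoly K[k.+1]})
    (z := fun j => y (lift ord0 j) - y ord0 ^+ (N ^ lift ord0 j)) :
  (map_poly (mmap phi z) (nagata f)).[y ord0] = mmap phi y f.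
Proof.
rewrite /nagata [X in map_poly _ X]/mmap [RHS]/mmap rmorph_sum horner_sum; apply: eq_bigr => m _ /=.
rewrite rmorphM hornerM /= map_polyC hornerC /= mmapC; congr (_ * _).
rewrite /mmap1 rmorph_prod horner_prod; apply: eq_bigr => i _ /=.
rewrite rmorphXn horner_exp; congr (_ ^+ _).
rewrite /nagata_var rmorphD hornerD /= map_polyXn hornerXn.
case: unliftP => [j ->|->]; last by rewrite rmorph0 horner0 addr0 expn0 expr1.
by rewrite map_polyC hornerC /= mmapX mmap1U /z addrC subrK.
Qed.

End Nagata.

Section Nullstellensatz.
Variables (K L : fieldType) (phi : {rmorphism K -> L}).

Lemma integral_mmap k (B : comNzRingType) (psi : {rmorphism B -> L}) (y : 'I_k -> L)
    (f : {mpoly K[k]}) :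
  (forall c, integralOver psi (phi c)) -> (forall i, integralOver psi (y i)) ->
  integralOver psi (mmap phi y f).
Proof.
move=> Ic Iy; rewrite /mmap; elim/big_ind: _ => [|u v|m _]; first exact: integral0.
  exact: integral_add.
apply: integral_mul => //; rewrite /mmap1; elim/big_ind: _ => [|u v|i _]; first exact: integral1.
  exact: integral_mul.
elim: (m i) => [|d IH]; first by rewrite expr0; exact: integral1.
by rewrite exprS; exact: integral_mul.
Qed.

(** Without a relation [mmap phi y] is injective. The inverse of y_0 is integral; its monic equation
    of degree d, multiplied by y_0^d, becomes a polynomial relation with constant coefficient 1. *)
Lemma integral_field_dependent k (y : 'I_k.+1 -> L) :
  integralRange (mmap phi y) -> exists2 f : {mpoly K[k.+1]}, f != 0 & mmap phi y f = 0.
Proof.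
move=> Iy; apply: contrapT => H.
have inj (f : {mpoly K[k.+1]}) : mmap phi y f = 0 -> f = 0.
  by move=> f0; apply/eqP; apply: contrapT => /negP fn; apply: H; exists f.
have y0 : y ord0 != 0.
  apply/eqP => y0; have := inj 'X_ord0; rewrite mmapX mmap1U => /(_ y0)/(congr1 (mcoeff U_(ord0))).
  by rewrite mcoeffX eqxx mcoeff0 => /eqP; rewrite oner_eq0.
have [p mp rp] := Iy (y ord0)^-1.
pose d := (size p).-1.
have szp : size p = d.+1 by rewrite prednK // lt0n size_poly_eq0 monic_neq0.
pose q : {mpoly K[k.+1]} := \sum_(i < d.+1) p`_i * 'X_ord0 ^+ (d - i).
have q0 : q = 0.
  apply: inj; move: rp; rewrite /root horner_coef size_map_poly_id0; last first.
    by rewrite (eqP mp) rmorph1 oner_neq0.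
  rewrite szp => /eqP E; rewrite rmorph_sum -[RHS](mulr0 (y ord0 ^+ d)) -[X in _ = _ * X]E mulr_sumr.
  apply: eq_bigr => i _; rewrite coef_map /= rmorphM rmorphXn /= mmapX mmap1U mulrCA; congr (_ * _).
  by rewrite exprVn -expfB_cond ?(negPf y0) ?add0n // -ltnS.
have := congr1 (mcoeff 0%MM) q0; rewrite mcoeff0 rmorph_sum big_ord_recr /= subnn expr0 mulr1.
have -> : p`_d = 1 by move: mp; rewrite monicE lead_coefE szp => /eqP.
rewrite mcoeff1 eqxx big1 ?add0r => [/eqP|i _]; first by rewrite oner_eq0.
rewrite rmorphM rmorphXn /= mcoeffX -mdeg_eq0 mdeg1 /=.
by rewrite expr0n subn_eq0 leqNgt ltn_ord mulr0.
Qed.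

(* Noether normalization: if L is integral over K[y_0, ..., y_k], these
   elements are dependent since L is a field, and Nagata's change of variables
   makes y_0 integral over k new generators. *)
Lemma algebraic_of_integral k (y : 'I_k -> L) :
  integralRange (mmap phi y) -> integralRange phi.
Proof.
elim: k y => [|k IH] y Iy z.
  have [p mp rp] := Iy z; exists (map_poly (mcoeff 0%MM) p); first exact: monic_map.
  move: rp; rewrite -map_poly_comp; congr (root _ z); apply: eq_map_poly => c /=.
  by rewrite {1}(nvar0_mpolyC c) mmapC.
have [f f0 fy] := integral_field_dependent Iy.
(* The margin secures 1 < N besides exponents below N. *)
pose N := (msize f).+2.
have fN m : m \in msupp f -> forall i, (m i < N)%N.
  move=> /msize_mdeg_lt h i; apply: leq_trans (_ : mdeg m < N)%N; last by rewrite ltnS ltnW // ltnW.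
  by rewrite ltnS mdegE (bigD1 i) //= leq_addr.
have [c c0 cm] := @nagata_monic K k N isT f f0 fN.
pose t j := y (lift ord0 j) - y ord0 ^+ (N ^ lift ord0 j).
apply: (IH t) => u.
have Iphi b : integralOver (mmap phi t) (phi b).
  by rewrite -(mmapC t phi); exact: integral_id.
have I0 : integralOver (mmap phi t) (y ord0).
  exists (c%:MP%:P * nagata N f) => //.
  by rewrite /root rmorphM hornerM nagata_eval fy mulr0.
have I0n d : integralOver (mmap phi t) (y ord0 ^+ d).
  by elim: d => [|d H]; rewrite ?expr0 ?exprS; [exact: integral1|exact: integral_mul].
have Ii i : integralOver (mmap phi t) (y i).
  case: (unliftP ord0 i) => [j|] ->; last exact: I0.
  rewrite -(subrK (y ord0 ^+ (N ^ lift ord0 j)) (y _)); apply: integral_add => //.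
  by rewrite -/(t j) -(mmap1U t j) -(mmapX t phi); exact: integral_id.
have [p mp rp] := Iy u.
apply: (integral_root_monic (p := map_poly (mmap phi y) p)) => //; first exact: monic_map.
by apply/integral_poly => i; rewrite coef_map; exact: integral_mmap.
Qed.

End Nullstellensatz.

(** * Cohen-Macaulayness from the exchange property *)

Section CohenMacaulayOfExchange.
Variables (K : fieldType) (n : nat) (S : affine_semigroup n) (r : nat) (e : 'I_r -> 'X_{1..n}).
Local Notation A := (semigroup_algebra K S).
Local Notation mon := (monomial K S).
Hypothesis eP : simplicial_rays S e.

Lemma maximal_ideal_unit (M : prime_idealr A) a : maximal_ideal M -> a \notin M ->
  exists c, 1 - c * a \in M.
Proof.
move=> Mmax aM; have iM := idealr_is_ideal M.
have [[i [c [Mi E]]]|H] := pselect (add_ideal [set x | x \in M] a 1).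
  by exists c; rewrite E addrK.
have [J HJ] := is_ideal_idealr (add_ideal_ideal a iM) H.
case/negP: aM; apply: (Mmax J).
  by move=> x xM; apply/HJ; exact: sub_add_ideal.
by apply/HJ; exact: add_ideal_mem.
Qed.

Lemma monomialX u k : asg_set S u -> mon u ^+ k = mon (u *+ k).
Proof.
move=> Su; elim: k => [|k IH]; first by rewrite expr0 mulm0n monomial0.
by rewrite exprS IH mulmS monomialD //; exact: asgMn.
Qed.

Lemma monomial_sum (I : Type) (s : seq I) (F : I -> 'X_{1..n}) :
  (forall i, asg_set S (F i)) -> mon (\sum_(i <- s) F i) = \prod_(i <- s) mon (F i).
Proof.
move=> SF; elim: s => [|i s IH]; first by rewrite !big_nil monomial0.
by rewrite !big_cons monomialD ?IH //; exact: asg_sum.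
Qed.

(** Each monomial of A has a power that is a monomial in the rays, so L is integral over the ring
    generated by K and the images of the rays; hence L is algebraic over K. *)
Lemma field_quotient_algebraic (L : fieldType) (pi : {rmorphism A -> L}) (l : 'I_r) :
  (forall z, exists a, z = pi a) -> exists2 f, f != 0 & pi (ray_eval S e l f) = 0.
Proof.
move=> pisurj; have [eS _ edom] := eP.
pose phi : {rmorphism K -> L} := pi \o @sga_const K n S.
pose y j := pi (mon (e j)).
have Iy : integralRange (mmap phi y).
  move=> z; have [a ->] := pisurj z; rewrite (sga_expand a) rmorph_sum big_seq.
  elim/big_ind: _ => [|u v|m /msupp_asg Sm]; [exact: integral0|exact: integral_add|].
  rewrite rmorphM; apply: integral_mul.
    by rewrite -[pi _]/(phi _) -(mmapC y phi); exact: integral_id.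
  have [q [b [q0 E]]] := edom m Sm.
  exists ('X^q - (\prod_j 'X_j ^+ b j)%:P); first by rewrite monicXnsubC.
  rewrite rmorphB /= map_polyXn map_polyC /root hornerD hornerN hornerXn hornerC /=.
  rewrite subr_eq0 rmorph_prod -rmorphXn; apply/eqP.
  have -> : mon m ^+ q = \prod_j mon (e j) ^+ b j.
    rewrite monomialX // E monomial_sum; last by move=> j; exact: asgMn.
    by apply: eq_bigr => j _; rewrite monomialX.
  rewrite rmorph_prod; apply: eq_bigr => j _.
  by rewrite !rmorphXn /= mmapX mmap1U.
have [p mp rp] := algebraic_of_integral Iy (y l).
exists p; first exact: monic_neq0.
move: rp; rewrite /root => /eqP <-; rewrite /ray_eval -horner_map -map_poly_comp.
by [].
Qed.

Lemma maximal_ideal_algebraic (M : prime_idealr A) (l : 'I_r) : maximal_ideal M ->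
  exists2 f, f != 0 & ray_eval S e l f \in M.
Proof.
move=> Mmax; pose E : comNzRingType := {ideal_quot (M : idealr A)}.
pose pi : {rmorphism A -> E} := \pi_E%qT.
have pi0 a : (pi a = 0) <-> a \in M.
  have -> : (pi a = 0) <-> (pi a == pi 0) by rewrite rmorph0; split=> [->//|/eqP].
  by rewrite piE Quotient.equivE subr0.
have pisurj z : exists a, z = pi a by exists (repr z); rewrite [RHS]reprK.
(* The value 0 at 0 is imposed because the field structure prescribes it. *)
have Hinv (z : E) : exists z', (z != 0 -> z' * z = 1) /\ (z = 0 -> z' = 0).
  have [->|z0] := eqVneq z 0; first by exists 0.
  have [a zE] := pisurj z; rewrite zE in z0 *.
  have [|c cM] := @maximal_ideal_unit M a Mmax.
    by apply: contraNN z0 => /pi0 ->.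
  exists (pi c); split=> [_|az]; last by rewrite az eqxx in z0.
  apply/esym/eqP; rewrite -subr_eq0 -rmorphM -(rmorph1 pi) -rmorphB; apply/eqP.
  exact/pi0.
have [Einv HE] := choice Hinv.
have mulV (z : E) : z != 0 -> Einv z * z = 1 by have [] := HE z.
have inv0 : Einv 0 = 0 by have [_] := HE 0; apply.
pose EfieldMixin := GRing.ComNzRing_isField.Build E mulV inv0.
pose L : fieldType := HB.pack E EfieldMixin.
have [f f0 fE] := @field_quotient_algebraic L pi l pisurj.
by exists f => //; apply/pi0.
Qed.

Lemma cohen_macaulay_of_exchange : exchange_property S e -> cohen_macaulay A.
Proof.
move=> eX; have nA := @sga_noetherian K n S; split=> // M Mmax.
have H l : exists f, f != 0 /\ ray_eval S e l f \in M.
  by have [f] := maximal_ideal_algebraic l Mmax; exists f.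
have [f Hf] := choice H.
apply: (@cohen_macaulay_local_intro A M [seq ray_eval S e l (f l) | l <- enum 'I_r]) => //.
- by apply: rays_regular => // l; have [] := Hf l.
- by move=> _ /mapP[l _ ->]; have [] := Hf l.
- move=> k /prime_chainP[p cp]; rewrite size_map size_enum_ord -[r]card_ord.
  have [F FE] := finite_over_rays eP.
  apply: (@chain_bound K n S M k p 'I_r e F cp); first exact: (ray_neq0 eP).
  by move=> m Sm; right; have [g [b [gF _ E]]] := FE m Sm; exists g, b.
Qed.

End CohenMacaulayOfExchange.

(** * Extremal rays *)

Section MnmRow.
Variables (F : numDomainType) (n : nat).
Implicit Types (m u v : 'X_{1..n}).

Lemma mnm_rowD u v : mnm_row F (u + v)%MM = mnm_row F u + mnm_row F v.
Proof. by apply/rowP => j; rewrite !mxE mnmDE natrD. Qed.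

Lemma mnm_row0 : mnm_row F (0%MM : 'X_{1..n}) = 0.
Proof. by apply/rowP => j; rewrite !mxE mnm0E. Qed.

Lemma mnm_rowMn m k : mnm_row F (m *+ k)%MM = k%:R *: mnm_row F m.
Proof. by apply/rowP => j; rewrite !mxE mulmnE natrM mulrC. Qed.

Lemma mnm_row_inj : injective (@mnm_row F n).
Proof.
move=> u v /rowP uv; apply/mnmP => j; have := uv j; rewrite !mxE => /eqP.
by rewrite eqr_nat => /eqP.
Qed.

Lemma mnm_row_comb r (e : 'I_r -> 'X_{1..n}) b :
  mnm_row F (comb e b) = \sum_l (b l)%:R *: mnm_row F (e l).
Proof.
rewrite (big_morph _ mnm_rowD mnm_row0); apply: eq_bigr => l _.
exact: mnm_rowMn.
Qed.

(** Over R this is convertible to [cone], so its closure lemmas serve both for the cone of the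
    generators and for that of the rays. *)
Definition nonneg_comb r (e : 'I_r -> 'X_{1..n}) : set 'rV[F]_n :=
  [set v | exists c : 'I_r -> F, (forall i, 0 <= c i) /\ v = \sum_i c i *: mnm_row F (e i)].

Lemma nonneg_comb0 r (e : 'I_r -> 'X_{1..n}) : nonneg_comb e 0.
Proof. by exists (fun=> 0); split=> //; rewrite big1 // => i _; rewrite scale0r. Qed.

Lemma nonneg_combD r (e : 'I_r -> 'X_{1..n}) x y :
  nonneg_comb e x -> nonneg_comb e y -> nonneg_comb e (x + y).
Proof.
move=> [c [c0 ->]] [d [d0 ->]]; exists (fun i => c i + d i); split.
  by move=> i; rewrite addr_ge0.
by rewrite -big_split; apply: eq_bigr => i _; rewrite scalerDl.
Qed.

Lemma nonneg_combZ r (e : 'I_r -> 'X_{1..n}) t x : 0 <= t ->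
  nonneg_comb e x -> nonneg_comb e (t *: x).
Proof.
move=> t0 [c [c0 ->]]; exists (fun i => t * c i); split.
  by move=> i; rewrite mulr_ge0.
by rewrite scaler_sumr; apply: eq_bigr => i _; rewrite scalerA.
Qed.

Lemma nonneg_comb_mem r (e : 'I_r -> 'X_{1..n}) i : nonneg_comb e (mnm_row F (e i)).
Proof.
exists (fun j => (j == i)%:R); split=> [j|]; first by rewrite ler0n.
rewrite (bigD1 i) //= eqxx scale1r big1 ?addr0 // => j /negPf ->.
by rewrite scale0r.
Qed.

Lemma nonneg_comb_sum r (e : 'I_r -> 'X_{1..n}) (I : finType) (P : pred I) (G : I -> 'rV[F]_n) :
  (forall i, P i -> nonneg_comb e (G i)) -> nonneg_comb e (\sum_(i | P i) G i).
Proof.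
move=> H; elim/big_ind: _ => //; [exact: nonneg_comb0|exact: nonneg_combD].
Qed.

Lemma nonneg_comb_span r (e : 'I_r -> 'X_{1..n}) m :
  semigroup_span (range e) m -> nonneg_comb e (mnm_row F m).
Proof.
move: m; apply: span_sub => [|_ [i _ <-]]; last exact: nonneg_comb_mem.
split=> [|u v]; first by rewrite mnm_row0; exact: nonneg_comb0.
by rewrite mnm_rowD; exact: nonneg_combD.
Qed.

End MnmRow.

Section ExtremalRays.
Variables (R : realType) (n k : nat) (g : 'I_k -> 'X_{1..n}).
Local Notation row m := (mnm_row R m).

Definition generates (T : 'I_k -> bool) := forall j, exists c : 'I_k -> R,
  (forall i, 0 <= c i) /\ row (g j) = \sum_(i | T i) c i *: row (g i).

Lemma generates_cone T x : generates T -> cone R g x -> exists c : 'I_k -> R,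
  (forall i, 0 <= c i) /\ x = \sum_(i | T i) c i *: row (g i).
Proof.
move=> TG [d [d0 ->]]; have [c Hc] := choice TG.
exists (fun i => \sum_j d j * c j i); split.
  by move=> i; apply: sumr_ge0 => j _; rewrite mulr_ge0 //; have [->] := Hc j.
under [RHS]eq_bigr do rewrite scaler_suml.
rewrite exchange_big; apply: eq_bigr => j _.
have [_ {1}->] := Hc j; rewrite scaler_sumr; apply: eq_bigr => i _.
by rewrite scalerA.
Qed.

Definition minimal_generating T := generates T /\
  forall i c, T i -> (forall j, 0 <= c j) ->
    row (g i) <> \sum_(j | T j && (j != i)) c j *: row (g j).

(** Take a generating subset of least cardinality: a member that is a combination of the others
    could be substituted away. *)
Lemma exists_minimal_generating : exists T, minimal_generating T.
Proof.
pose T0 : {ffun 'I_k -> bool} := [ffun=> true].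
have G0 : `[< generates T0 >].
  apply/asboolP => j; have [c [c0 E]] := nonneg_comb_mem R g j.
  by exists c; split=> //; rewrite E; apply: eq_bigl => i; rewrite ffunE.
case: (@arg_minnP _ T0 (fun T => `[< generates T >]) (fun T : {ffun 'I_k -> bool} => #|[pred i | T i]|) G0).
move=> T /asboolP TG Tmin; exists T; split=> // i c Ti c0 E.
pose T' : {ffun 'I_k -> bool} := [ffun j => T j && (j != i)].
have : (#|[pred i | T i]| <= #|[pred i | T' i]|)%N.
  apply: Tmin; apply/asboolP => j; have [d [d0 dE]] := TG j.
  exists (fun l => d l + d i * c l); split.
    by move=> l; rewrite addr_ge0 // mulr_ge0.
  rewrite (eq_bigl (fun l => T l && (l != i))); last by move=> l; rewrite ffunE.
  rewrite dE (bigD1 i) //= E scaler_sumr addrC -big_split /=.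
  by apply: eq_bigr => l _; rewrite scalerDl scalerA.
rewrite leqNgt => /negP; apply; apply: proper_card; apply/properP; split.
  by apply/fintype.subsetP => l; rewrite !inE ffunE => /andP[].
by exists i; rewrite !inE ?ffunE ?eqxx ?andbF.
Qed.

Lemma sum_rows_eq0 (T : pred 'I_k) (c : 'I_k -> R) : (forall i, 0 <= c i) ->
  \sum_(i | T i) c i *: row (g i) = 0 -> forall i, T i -> c i *: row (g i) = 0.
Proof.
move=> c0 /rowP E i Ti; apply/rowP => j; have := E j; rewrite summxE mxE => /eqP.
rewrite psumr_eq0 => [/allP/(_ i (mem_index_enum i))|l _].
  by rewrite Ti => /eqP.
by rewrite !mxE mulr_ge0.
Qed.

(** Let x + y = t g_i, and let s_j be the sums of the coefficients of x and y. If s_i < t, then g_i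
    is a combination of the other generators, against minimality. Otherwise (s_i - t) g_i plus the
    other s_j g_j is a vanishing sum of nonnegative vectors, so x is a multiple of g_i. *)
Lemma minimal_generator_extremal T i : minimal_generating T -> T i ->
  extremal_ray_of_cone (cone R g) (ray (row (g i))).
Proof.
move=> [TG Tmin] Ti; split.
- exists (row (g i)) => //; apply/eqP => E.
  apply: (Tmin i (fun=> 0) Ti) => //; rewrite big1 // => j _; exact: scale0r.
- by move=> _ [t t0 <-]; apply: nonneg_combZ => //; exact: nonneg_comb_mem.
- have half x y : cone R g x -> cone R g y -> ray (row (g i)) (x + y) -> ray (row (g i)) x.
    move=> /(generates_cone TG)[c [c0 ->]] /(generates_cone TG)[d [d0 ->]] [t t0].
    pose s j := c j + d j.
    have s0 j : 0 <= s j by rewrite addr_ge0.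
    rewrite -big_split (eq_bigr (fun j => s j *: row (g j))); last first.
      by move=> j _; rewrite scalerDl.
    rewrite (bigD1 i) //= => E.
    have [lt|le] := ltP (s i) t.
      case: (Tmin i (fun j => (t - s i)^-1 * s j) Ti).
        by move=> j; rewrite mulr_ge0 // invr_ge0 subr_ge0 ltW.
      have ts : t - s i != 0 by rewrite subr_eq0 gt_eqF.
      under eq_bigr do rewrite -scalerA.
      rewrite -scaler_sumr; apply: (scalerI ts).
      by rewrite scalerA divff // scale1r scalerBl E addrAC subrr add0r.
    have Z : \sum_(j | T j) (if j == i then s i - t else s j) *: row (g j) = 0.
      rewrite (bigD1 i) //= eqxx scalerBl E opprD addrA subrr sub0r.
      by rewrite [X in _ + X](eq_bigr (fun j => s j *: row (g j))) ?addNr // => j /andP[_ /negPf ->].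
    have Z0 j : T j -> j != i -> c j *: row (g j) = 0.
      move=> Tj ji; have := sum_rows_eq0 _ Z Tj; rewrite (negPf ji) => H.
      apply/rowP => l; rewrite !mxE; apply: le_anti; apply/andP; split; last by rewrite mulr_ge0.
      have /rowP/(_ l) : s j *: row (g j) = 0.
        by apply: H => h; case: ifP => _ //; rewrite subr_ge0.
      by rewrite !mxE => <-; rewrite ler_wpM2r // lerDl.
    exists (c i) => //=; rewrite (bigD1 i) //= [X in _ + X]big1 ?addr0 // => j /andP[Tj].
    exact: Z0.
  by move=> x y Cx Cy L; split; [exact: half L|apply: half Cy Cx _; rewrite addrC].
Qed.

(** Take w of least degree. Any v on the ray is comparable with w, and v <= w forces equality by
    degree. *)
Lemma smallest_on_ray (S : set 'X_{1..n}) i : S (g i) -> g i != 0%MM ->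
  exists w, [/\ S w, w != 0%MM, ray (row (g i)) (row w) &
    forall v, S v -> v != 0%MM -> ray (row (g i)) (row v) -> (w <= v)%MM].
Proof.
move=> Sg g0.
have ex : exists d, `[< exists w, [/\ S w, w != 0%MM, ray (row (g i)) (row w) & mdeg w = d] >].
  exists (mdeg (g i)); apply/asboolP; exists (g i); split=> //.
  by exists 1; rewrite /= ?ler01 ?scale1r.
case: (ex_minnP ex) => d /asboolP[w [Sw w0 Lw wd]] dmin.
exists w; split=> // v Sv v0 Lv.
have le (s t : R) u u' : s <= t -> s *: row (g i) = row u -> t *: row (g i) = row u' -> (u <= u')%MM.
  move=> st /rowP E /rowP E'; apply/mnm_lepP => j; rewrite -(ler_nat R).
  have := E j; have := E' j; rewrite !mxE => <- <-.
  by rewrite ler_wpM2r.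
have [s s0 sE] := Lw; have [t t0 tE] := Lv.
have [st|/ltW ts] := leP s t; first exact: le st sE tE.
have vw := le _ _ _ _ ts tE sE.
have : (mdeg w <= mdeg v)%N by rewrite wd; apply: dmin; apply/asboolP; exists v.
rewrite -(submK vw) mdegD => H.
have -> : (w - v = 0)%MM by apply/eqP; rewrite -mdeg_eq0; lia.
by rewrite add0m; exact: lepm_refl.
Qed.

(** The generators in a minimal generating set span extremal rays, so each is a positive multiple of
    the smallest element of S on its ray, which is some e_l. *)
Lemma nonneg_comb_extremal r (e : 'I_r -> 'X_{1..n}) (S : set 'X_{1..n}) m :
  semigroup_span (range g) = S -> extremal_rays R g S = range e -> S m ->
  nonneg_comb e (row m).
Proof.
move=> gS ge Sm; have [T Tm] := exists_minimal_generating.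
have [TG Tmin] := Tm.
have Cm : cone R g (row m) by apply: nonneg_comb_span; rewrite gS.
have [c [c0 ->]] := generates_cone TG Cm.
apply: nonneg_comb_sum => i Ti; apply: nonneg_combZ => //.
have Lext := minimal_generator_extremal Tm Ti.
have Sg : S (g i) by rewrite -gS; apply: span_mem; exists i.
have g0 : g i != 0%MM.
  apply/eqP => E; apply: (Tmin i (fun=> 0) Ti) => //.
  by rewrite E mnm_row0 big1 // => j _; rewrite scale0r.
have [w [Sw w0 Lw wmin]] := smallest_on_ray Sg g0.
have : extremal_rays R g S w by split=> //; exists (ray (row (g i))); split.
rewrite ge => -[l _ elw]; have [s s0 sE] := Lw.
have sn0 : s != 0.
  apply: contra w0 => /eqP sz; apply/eqP/(@mnm_row_inj R).
  by rewrite -sE sz scale0r mnm_row0.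
have -> : row (g i) = s^-1 *: row (e l) by rewrite elw -sE scalerA mulVf // scale1r.
by apply: nonneg_combZ; [rewrite invr_ge0|exact: nonneg_comb_mem].
Qed.

End ExtremalRays.

(** * Rational coordinates along independent rays *)

Lemma rat_clear_denominators (r : nat) (x : 'I_r -> rat) : (forall l, 0 <= x l) ->
  exists q (b : 'I_r -> nat), (0 < q)%N /\ forall l, q%:R * x l = (b l)%:R.
Proof.
move=> x0; pose d l := `|denq (x l)|%N; pose q := (\prod_l d l)%N.
have H l : exists b : nat, q%:R * x l = b%:R.
  have dn : (d l)%:R = (denq (x l))%:~R :> rat.
    by rewrite pmulrn /d gez0_abs // denq_ge0.
  exists ((\prod_(i < r | i != l) d i) * `|numq (x l)|)%N.
  rewrite /q (bigD1 l) //= !natrM -mulrA mulrC -mulrA; congr (_ * _).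
  have xE : x l * (denq (x l))%:~R = (numq (x l))%:~R.
    by rewrite -{1}(divq_num_den (x l)) divfK // intr_eq0 denq_neq0.
  by rewrite dn xE [RHS]pmulrn gez0_abs // numq_ge0.
have [b Hb] := choice H; exists q, b; split=> //.
by apply: prodn_gt0 => l; rewrite absz_gt0 denq_neq0.
Qed.

Section FreeRays.
Variables (n r : nat) (e : 'I_r -> 'X_{1..n}).
Local Notation V := (\matrix_(l < r) mnm_row rat (e l)).
Hypothesis Vfree : row_free V.

Lemma comb_row b : mnm_row rat (comb e b) = (\row_l (b l)%:R) *m V.
Proof.
rewrite mnm_row_comb mulmx_sum_row; apply: eq_bigr => l _.
by rewrite mxE rowK.
Qed.

Lemma comb_free b c : comb e b = comb e c -> b =1 c.
Proof.
move=> /(congr1 (@mnm_row rat n)); rewrite !comb_row => /(row_free_inj Vfree) /rowP H l.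
by have := H l; rewrite !mxE => /eqP; rewrite eqr_nat => /eqP.
Qed.

Lemma map_mnm_row (R : realType) (m : 'X_{1..n}) : map_mx (ratr : rat -> R) (mnm_row rat m) = mnm_row R m.
Proof. by apply/rowP => j; rewrite !mxE ratr_nat. Qed.

(** Membership of a rational vector in the row space descends from R to the rationals, and by
    independence the real coefficients are the rational ones; it remains to clear denominators. *)
Lemma nonneg_comb_rational (R : realType) m : nonneg_comb e (mnm_row R m) ->
  exists q b, (0 < q)%N /\ (m *+ q)%MM = comb e b.
Proof.
move=> [c [c0 E]].
have VR : map_mx (ratr : rat -> R) V = \matrix_(l < r) mnm_row R (e l).
  by apply/matrixP => i j; rewrite !mxE ratr_nat.
have E' : mnm_row R m = (\row_l c l) *m map_mx ratr V.
  rewrite E mulmx_sum_row; apply: eq_bigr => l _.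
  by rewrite mxE VR rowK.
have sub : (mnm_row rat m <= V)%MS.
  by rewrite -(map_submx (ratr : {rmorphism rat -> R})) map_mnm_row E' submxMl.
have [x xE] := submxP sub.
have cx l : c l = ratr (x 0 l).
  have : \row_l c l = map_mx (ratr : rat -> R) x.
    apply: (@row_free_inj _ _ _ _ (map_mx (ratr : {rmorphism rat -> R}) V)).
      by rewrite row_free_map.
    by rewrite /mulmxr -E' -map_mnm_row xE map_mxM.
  by move=> /rowP/(_ l); rewrite !mxE.
have x0 l : 0 <= x 0 l by rewrite -(ler0q R) -cx.
have [q [b [q0 qb]]] := rat_clear_denominators x0; exists q, b; split=> //.
apply: (@mnm_row_inj rat); rewrite mnm_rowMn comb_row xE scalemxAl.
by congr (_ *m _); apply/rowP => l; rewrite !mxE qb.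
Qed.

End FreeRays.

Lemma simplicial_rays_of_extremal (R : realType) n k r (g : 'I_k -> 'X_{1..n})
    (e : 'I_r -> 'X_{1..n}) (S : affine_semigroup n) :
  semigroup_span (range g) = S -> extremal_rays R g S = range e ->
  row_free (\matrix_(l < r) mnm_row rat (e l)) -> simplicial_rays S e.
Proof.
move=> gS ge Vfree; split.
- move=> l; have : extremal_rays R g S (e l); last by case.
  by rewrite ge; exists l.
- exact: comb_free.
- move=> m Sm; apply: (nonneg_comb_rational Vfree (R := R)).
  exact: nonneg_comb_extremal gS ge Sm.
Qed.

Lemma row_free_usub (F : fieldType) m1 m2 n (A : 'M[F]_(m1, n)) (B : 'M[F]_(m2, n)) :
  row_free (col_mx A B) -> row_free A.
Proof.
move=> fAB; apply/inj_row_free => v vA.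
have : row_mx v 0 *m col_mx A B = 0 by rewrite mul_row_col vA mul0mx addr0.
move/eqP; rewrite mulmx_free_eq0 // => /eqP H.
by rewrite -[v](row_mxKl v (0 : 'rV_m2)) H linear0.
Qed.

Lemma row_free_dsub (F : fieldType) m1 m2 n (A : 'M[F]_(m1, n)) (B : 'M[F]_(m2, n)) :
  row_free (col_mx A B) -> row_free B.
Proof.
move=> fAB; apply/inj_row_free => v vB.
have : row_mx 0 v *m col_mx A B = 0 by rewrite mul_row_col vB mul0mx addr0.
move/eqP; rewrite mulmx_free_eq0 // => /eqP H.
by rewrite -[v](row_mxKr (0 : 'rV_m1) v) H linear0.
Qed.

(** * The join *)

Section Join.
Variables (n r1 r2 : nat) (e1 : 'I_r1 -> 'X_{1..n}) (e2 : 'I_r2 -> 'X_{1..n}).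
Variables (S1 S2 S : affine_semigroup n).
Hypotheses (eP1 : simplicial_rays S1 e1) (eP2 : simplicial_rays S2 e2).
Hypothesis SE : forall m, asg_set S m <->
  exists u v, [/\ asg_set S1 u, asg_set S2 v & m = (u + v)%MM].
Hypothesis free : row_free (col_mx (\matrix_(i < r1) mnm_row rat (e1 i))
                                   (\matrix_(i < r2) mnm_row rat (e2 i))).

Definition join_rays (i : 'I_(r1 + r2)) :=
  match split i with inl j => e1 j | inr j => e2 j end.

Lemma join_raysl j : join_rays (lshift r2 j) = e1 j.
Proof. by rewrite /join_rays (unsplitK (inl j)). Qed.

Lemma join_raysr j : join_rays (rshift r1 j) = e2 j.
Proof. by rewrite /join_rays (unsplitK (inr j)). Qed.

Lemma comb_join b : comb join_rays b =
  (comb e1 (fun j => b (lshift r2 j)) + comb e2 (fun j => b (rshift r1 j)))%MM.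
Proof.
rewrite /comb big_split_ord; congr (_ + _)%MM; apply: eq_bigr => j _.
  by rewrite join_raysl.
by rewrite join_raysr.
Qed.

Lemma join_rays_free : row_free (\matrix_(i < r1 + r2) mnm_row rat (join_rays i)).
Proof.
suff -> : \matrix_(i < r1 + r2) mnm_row rat (join_rays i) =
  col_mx (\matrix_(i < r1) mnm_row rat (e1 i)) (\matrix_(i < r2) mnm_row rat (e2 i)) by [].
apply/row_matrixP => i; rewrite rowK.
by case: (split_ordP i) => j ->; rewrite ?join_raysl ?join_raysr ?rowKu ?rowKd rowK.
Qed.

Definition join_coef (b1 : 'I_r1 -> nat) (b2 : 'I_r2 -> nat) (i : 'I_(r1 + r2)) :=
  match split i with inl j => b1 j | inr j => b2 j end.

Lemma comb_join_coef b1 b2 : comb join_rays (join_coef b1 b2) = (comb e1 b1 + comb e2 b2)%MM.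
Proof.
rewrite comb_join; congr (_ + _)%MM; apply: eq_bigr => j _; rewrite /join_coef.
  by rewrite (unsplitK (inl j)).
by rewrite (unsplitK (inr j)).
Qed.

Lemma join_simplicial_rays : simplicial_rays S join_rays.
Proof.
have [eS1 _ edom1] := eP1; have [eS2 _ edom2] := eP2; split.
- move=> l; apply/SE; case: (split_ordP l) => j ->.
    by exists (e1 j), 0%MM; rewrite join_raysl addm0; split=> //; exact: asg0.
  by exists 0%MM, (e2 j); rewrite join_raysr add0m; split=> //; exact: asg0.
- exact: (comb_free join_rays_free).
- move=> _ /SE[u [v [/edom1[q [b [q0 E]]] /edom2[q' [b' [q0' E']]] ->]]].
  exists (q * q')%N, (join_coef (fun l => b l * q')%N (fun l => b' l * q)%N).
  rewrite muln_gt0 q0 q0' comb_join_coef !combM -E -E' -!mulmnM mulmDn.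
  by rewrite [(q' * q)%N]mulnC.
Qed.

Lemma common_multiple (S0 : affine_semigroup n) r (e : 'I_r -> 'X_{1..n}) u u' :
  simplicial_rays S0 e -> asg_set S0 u -> asg_set S0 u' ->
  exists q b b', [/\ (0 < q)%N, (u *+ q)%MM = comb e b & (u' *+ q)%MM = comb e b'].
Proof.
move=> [_ _ edom] /edom[q [b [q0 E]]] /edom[q' [b' [q0' E']]].
exists (q * q')%N, (fun l => b l * q')%N, (fun l => b' l * q)%N.
rewrite muln_gt0 q0 q0' !combM -E -E' -!mulmnM; split=> //.
by rewrite mulnC.
Qed.

(** A common multiple of both sides is a combination of the joint rays, whose coefficients are
    unique. Comparing those on [e1] gives equal multiples of u and u', and multiplication by q is
    injective. *)
Lemma join_unique u v u' v' : asg_set S1 u -> asg_set S1 u' -> asg_set S2 v ->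
  asg_set S2 v' -> (u + v = u' + v')%MM -> u = u' /\ v = v'.
Proof.
move=> Su Su' Sv Sv' E; suff uu' : u = u'.
  by split=> //; move: E; rewrite uu' => /addmI.
have [q [b [b' [q0 uE uE']]]] := common_multiple eP1 Su Su'.
have [p [c [c' [p0 vE vE']]]] := common_multiple eP2 Sv Sv'.
have := congr1 (fun m => m *+ (q * p))%MM E; rewrite /= !mulmDn.
rewrite [in X in (_ + X)%MM = _]mulnC [in X in _ = (_ + X)%MM]mulnC !mulmnM.
rewrite uE uE' vE vE' -!combM -!comb_join_coef => /(comb_free join_rays_free) H.
apply: (mulmn_inj q0); rewrite /= uE uE'; apply: eq_bigr => j _.
have := H (lshift r2 j); rewrite /join_coef (unsplitK (inl j)) => /eqP.
by rewrite eqn_pmul2r // => /eqP ->.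
Qed.

(** By [join_unique] the relation splits into its two components. For rays from the same semigroup
    the exchange happens in that component and the other is carried along; for rays from different
    ones the splitting itself exhibits e_j as a summand. *)
Lemma join_exchange : exchange_property S1 e1 -> exchange_property S2 e2 ->
  exchange_property S join_rays.
Proof.
have [eS1 _ _] := eP1; have [eS2 _ _] := eP2.
move=> X1 X2 j l _ _ jl /SE[u [v [Su Sv ->]]] /SE[u' [v' [Su' Sv' ->]]].
have S12 x y : asg_set S1 x -> asg_set S2 y -> asg_set S (x + y)%MM.
  by move=> Sx Sy; apply/SE; exists x, y.
case: (split_ordP l) jl => l' ->; case: (split_ordP j) => j' -> jl;
  rewrite ?join_raysl ?join_raysr.
- rewrite addmAC [(u' + v' + _)%MM]addmAC => /join_unique[||||E ?] //; try exact: asgD.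
  have [|w Sw ->] := X1 j' l' u u' _ Su Su' E; first by rewrite (inj_eq (@lshift_inj _ _)) in jl.
  by exists (w + v)%MM; [exact: S12|rewrite addmAC].
- rewrite addmAC -[(u' + v' + _)%MM]addmA => /join_unique[||||E ->] //; try exact: asgD.
  by exists (u + v')%MM; [exact: S12|rewrite addmA].
- rewrite -addmA [(u' + v' + _)%MM]addmAC => /join_unique[||||-> E] //; try exact: asgD.
  by exists (u' + v)%MM; [exact: S12|rewrite addmAC].
- rewrite -!addmA => /join_unique[||||? E] //; try exact: asgD.
  have [|w Sw ->] := X2 j' l' v v' _ Sv Sv' E; first by rewrite (inj_eq (@rshift_inj _ _)) in jl.
  by exists (u + w)%MM; [exact: S12|rewrite addmA].
Qed.

End Join.

Lemma semigroup_join_addE n k1 k2 (a : 'I_k1 -> 'X_{1..n}) (b : 'I_k2 -> 'X_{1..n})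
    (S1 S2 : affine_semigroup n) m :
  semigroup_span (range a) = S1 -> semigroup_span (range b) = S2 ->
  asg_set (semigroup_join (codom a) (codom b)) m <->
    exists u v, [/\ asg_set S1 u, asg_set S2 v & m = (u + v)%MM].
Proof.
move=> aS bS; split.
  move: m; apply: span_sub.
    split; first by exists 0%MM, 0%MM; rewrite addm0; split=> //; exact: asg0.
    move=> _ _ [u [v [Su Sv ->]]] [u' [v' [Su' Sv' ->]]].
    exists (u + u')%MM, (v + v')%MM; split; [exact: asgD|exact: asgD|].
    by apply/mnmP => i; rewrite !mnmDE addnACA.
  move=> m /=; rewrite mem_cat => /orP[/codomP[i ->]|/codomP[i ->]].
    exists (a i), 0%MM; rewrite addm0; split=> //; last exact: asg0.
    by rewrite -aS; apply: span_mem; exists i.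
  exists 0%MM, (b i); rewrite add0m; split=> //; first exact: asg0.
  by rewrite -bS; apply: span_mem; exists i.
move=> [u [v [Su Sv ->]]]; apply: asgD; [move: Su|move: Sv].
  rewrite -aS; apply: span_sub; first exact: semigroup_span_closed.
  by move=> _ [i _ <-]; apply: span_mem; rewrite /= mem_cat codom_f.
rewrite -bS; apply: span_sub; first exact: semigroup_span_closed.
by move=> _ [i _ <-]; apply: span_mem; rewrite /= mem_cat codom_f orbT.
Qed.

Theorem corollary4p3 (R : realType) (K : fieldType) (r1 n1 r2 n2 : nat)
    (a : 'I_(r1 + n1) -> 'X_{1..(r1 + r2)})
    (b : 'I_(r2 + n2) -> 'X_{1..(r1 + r2)})
    (Gamma1 Gamma2 : affine_semigroup (r1 + r2))
    (a_inj : injective a) (b_inj : injective b)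
    (ab_disjoint : range a `&` range b = set0)
    (a_min_gen : minimally_generated Gamma1 (range a))
    (b_min_gen : minimally_generated Gamma2 (range b))
    (a_extremal : extremal_rays R a Gamma1 = range (fun i => a (lshift n1 i)))
    (b_extremal : extremal_rays R b Gamma2 = range (fun i => b (lshift n2 i)))
    (ab_free : row_free
       (col_mx (\matrix_(i < r1) mnm_row rat (a (lshift n1 i)))
               (\matrix_(i < r2) mnm_row rat (b (lshift n2 i))))) :
  cohen_macaulay (semigroup_algebra K Gamma1) ->
  cohen_macaulay (semigroup_algebra K Gamma2) ->
  cohen_macaulay (semigroup_algebra K (semigroup_join (codom a) (codom b))).
Proof.
have [aS _] := a_min_gen; have [bS _] := b_min_gen.
have eP1 := simplicial_rays_of_extremal aS a_extremal (row_free_usub ab_free).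
have eP2 := simplicial_rays_of_extremal bS b_extremal (row_free_dsub ab_free).
have SE m := semigroup_join_addE m aS bS.
move=> /(exchange_of_cohen_macaulay eP1) X1 /(exchange_of_cohen_macaulay eP2) X2.
apply: (cohen_macaulay_of_exchange K (join_simplicial_rays eP1 eP2 SE ab_free)).
exact: (join_exchange eP1 eP2 SE ab_free X1 X2).
Qed.
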